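(* Fix $0<d<n$. Let $D$ be the combinatorial type of a simplicial Quantum Fan in $\mathbb R^d$, containing at least one cone of dimension $d$. The moduli space $\hat{\mathscr M}^{D,n,d}_{\mathrm{toric}}$ of calibrated Quantum Toric Varieties of maximal length and fixed combinatorial type $D$ can be endowed with a structure of a real orbifold of dimension $d(n-d)$.
   Context: Let $\Gamma\subset\mathbb R^d$ be a finitely generated additive subgroup spanning $\mathbb R^d$. A calibrated Quantum Fan $(\Delta,h)$ in $\Gamma$ is: a collection $\Delta$ of strongly convex cones generated by elements of $\Gamma$, containing $0$ and closed under intersections and faces; an epimorphism $h:\mathbb Z^n\to\Gamma$; a set $J\subset\{1,\dots,n\}$ of virtual generators with $\{h(e_i):i\notin J\}$ spanning; a set of generators $I_0=\{i_1,\dots,i_p\}$ disjoint from $J$ such that the $1$-cones of $\Delta$ are exactly those generated by the $v_k=h(e_{i_k})$. Simplicial: every cone is over a simplex. Maximal length: $|J|=n-p$. The combinatorial type of $\Delta$ is the poset of subsets $I\subset\{1,\dots,p\}$ such that $(v_i)_{i\in I}$ generates a cone of $\Delta$ (with these rays); two types are equivalent if they have the same $p$ and correspond under a bijection of $\{1,\dots,p\}$. An isomorphism of calibrated Quantum Fans of maximal length $(\Delta,h)\to(\Delta',h')$ is a pair $(L,H)$: $L$ a linear isomorphism with $L(\Gamma)=\Gamma'$, mapping cones of $\Delta$ bijectively to cones of $\Delta'$ and the $1$-cone generators to a permutation of those of $\Delta'$; $H\in GL_n(\mathbb Z)$ a permutation matrix mapping $\{e_i\}_{i\in I_0}$ to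 $\{e_i\}_{i\in I_0'}$ and $\{e_j\}_{j\in J}$ to $\{e_j\}_{j\in J'}$; $L\circ h=h'\circ H$. Isomorphism classes of simplicial calibrated Quantum Toric Varieties correspond to isomorphism classes of simplicial calibrated Quantum Fans; $\hat{\mathscr M}^{D,n,d}_{\mathrm{toric}}$ is the set of isomorphism classes of simplicial calibrated Quantum Fans of maximal length in $\mathbb R^d$, with calibration defined on $\mathbb Z^n$, and combinatorial type equivalent to $D$. Each class is represented by a standard one: $h(p,q)=p+\hbar(q)$ on $\mathbb Z^d\times\mathbb Z^{n-d}$, with $I_0=\{1,\dots,p\}$, $J=\{p+1,\dots,n\}$, so it is described by $\hbar=(\hbar(e_{d+1}),\dots,\hbar(e_n))$ in an open set of $(\mathbb R^d)^{n-d}$, and the moduli space has the quotient topology. A real orbifold is a stack over the category of $C^\infty$-manifolds (with usual euclidean coverings) with only finite isotropy groups.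
   Formalization: ''Closed under intersections'' is read as the usual fan axiom: the intersection of two cones of the Quantum Fan is a common face of both (otherwise crossing cones are allowed and the parameter set need not be open); distinct generators v_k span distinct 1-cones. *)

(* Defs.v *)
From HB Require Import structures.
From mathcomp Require Import all_boot all_order all_algebra all_fingroup.
From mathcomp Require Import all_classical all_reals.
From mathcomp Require Import topology normedtype derive.

Set Implicit Arguments.
Unset Strict Implicit.
Unset Printing Implicit Defensive.

Import Order.TTheory GRing.Theory Num.Theory.
Import numFieldNormedType.Exports.

Local Open Scope classical_set_scope.
Local Open Scope ring_scope.

(******************************************************************************)
(* Cones in R^d. Vectors are row vectors, and a finite family of k vectors is *)
(* the family of rows of a matrix in 'M[R]_(k, d).                            *)
(******************************************************************************)

Definition lin_span (R : realType) d (S : set 'rV[R]_d) : set 'rV[R]_d :=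
  [set x | exists k (w : 'M[R]_(k, d)),
     (forall i, S (row i w)) /\ (x <= w)%MS].

Definition fg_subgroup (R : realType) d (G : set 'rV[R]_d) : Prop :=
  exists k (g : 'M[R]_(k, d)),
    G = range (fun c : 'rV[int]_k => map_mx intr c *m g).

Definition cone_on (R : realType) k d (w : 'M[R]_(k, d)) (I : {set 'I_k}) :
    set 'rV[R]_d :=
  [set c *m w | c in [set c : 'rV[R]_k | (forall i, 0 <= c 0 i) /\
                                         (forall i, i \notin I -> c 0 i = 0)]].

Definition cone_of (R : realType) k d (w : 'M[R]_(k, d)) : set 'rV[R]_d :=
  cone_on w [set: 'I_k].

Definition ray (R : realType) d (v : 'rV[R]_d) : set 'rV[R]_d := cone_of v.

Definition strongly_convex (R : realType) d (s : set 'rV[R]_d) : Prop :=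
  forall x, s x -> s (- x) -> x = 0.

Definition face (R : realType) d (t s : set 'rV[R]_d) : Prop :=
  exists u : 'cV[R]_d, (forall x, s x -> 0 <= (x *m u) 0 0) /\
    t = [set x | s x /\ (x *m u) 0 0 = 0].

(* The dimension of the linear span of s is k. *)
Definition cone_dim (R : realType) d (s : set 'rV[R]_d) (k : nat) : Prop :=
  exists w : 'M[R]_(k, d),
    [/\ row_free w, forall i, s (row i w) & forall x, s x -> (x <= w)%MS].

Definition simplicial_cone (R : realType) d (s : set 'rV[R]_d) : Prop :=
  exists k (w : 'M[R]_(k, d)), row_free w /\ s = cone_of w.

(******************************************************************************)
(* Quantum fans                                                               *)
(******************************************************************************)

(* As for any fan, the intersection of two cones is not only a cone of the    *)
(* fan but also a common face of both; v_k is row k of qgens, and distinct    *)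
(* indices k correspond to distinct 1-cones.                                  *)
Record quantum_fan (R : realType) (d p : nat) := QuantumFan {
  qgroup : set 'rV[R]_d;
  qgroup_fg : fg_subgroup qgroup;
  qgroup_span : lin_span qgroup = setT;
  qcones : set (set 'rV[R]_d);
  qcones_gen : forall s, qcones s -> exists k (w : 'M[R]_(k, d)),
    (forall i, qgroup (row i w)) /\ s = cone_of w;
  qcones_sc : forall s, qcones s -> strongly_convex s;
  qcones0 : qcones [set 0];
  qcones_face : forall s t, qcones s -> face t s -> qcones t;
  qcones_cap : forall s t, qcones s -> qcones t ->
    [/\ qcones (s `&` t), face (s `&` t) s & face (s `&` t) t];
  qgens : 'M[R]_(p, d);
  qgens_group : forall k, qgroup (row k qgens);
  qgens_rays : set_bij [set: 'I_p] [set s | qcones s /\ cone_dim s 1]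
                       (fun k => ray (row k qgens)) }.

Definition simplicial_fan (R : realType) d p (F : quantum_fan R d p) : Prop :=
  forall s, qcones F s -> simplicial_cone s.

Definition comb_type (R : realType) d p (F : quantum_fan R d p) :
    {set {set 'I_p}} :=
  [set I | `[< let s := cone_on (qgens F) I in qcones F s /\
       [set t | face t s /\ cone_dim t 1] =
       [set ray (row i (qgens F)) | i in [set i | i \in I]] >]].

Definition type_equiv p (D E : {set {set 'I_p}}) : Prop :=
  exists s : {perm 'I_p},
    E = [set [set s i | i in I] | I : {set 'I_p} in D]%SET.

(* The calibration h : Z^n -> Gamma is seen as a map into R^d with range      *)
(* Gamma; cidx k is the index i_k, so that I_0 is the range of cidx.          *)
Record cal_fan (R : realType) (d n p : nat) := CalFan {
  cfan :> quantum_fan R d p;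
  calib : {additive 'rV[int]_n -> 'rV[R]_d};
  calib_epi : range calib = qgroup cfan;
  cvirt : {set 'I_n};
  cvirt_span :
    lin_span [set calib (delta_mx 0 i) | i in [set i | i \notin cvirt]] = setT;
  cidx : 'I_p -> 'I_n;
  cidx_inj : injective cidx;
  cidx_virt : forall k, cidx k \notin cvirt;
  cidx_gens : forall k, calib (delta_mx 0 (cidx k)) = row k (qgens cfan) }.

Definition maximal_length (R : realType) d n p (F : cal_fan R d n p) : Prop :=
  #|cvirt F| = (n - p)%N.

(* H acts on the row vectors of Z^n by right multiplication. *)
Definition basis_vectors n (A : set 'I_n) : set 'rV[int]_n :=
  [set delta_mx 0 i | i in A].

Definition cal_iso (R : realType) d n p (F F' : cal_fan R d n p) : Prop :=
  exists (L : 'M[R]_d) (H : 'M[int]_n),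
    [/\ L \in unitmx /\ [set x *m L | x in qgroup F] = qgroup F',
        set_bij (qcones F) (qcones F')
                (fun s : set 'rV[R]_d => [set x *m L | x in s]),
        exists s : {perm 'I_p},
          forall k, row k (qgens F) *m L = row (s k) (qgens F'),
        [/\ is_perm_mx H,
            [set x *m H | x in basis_vectors (range (cidx F))] =
              basis_vectors (range (cidx F')) &
            [set x *m H | x in basis_vectors [set i | i \in cvirt F]] =
              basis_vectors [set i | i \in cvirt F']] &
        forall x, calib F x *m L = calib F' (x *m H)].

(******************************************************************************)
(* The moduli space                                                           *)
(******************************************************************************)

Definition in_moduli (R : realType) d n p (D : {set {set 'I_p}})
    (F : cal_fan R d n p) : Prop :=
  [/\ simplicial_fan F, maximal_length F & type_equiv D (comb_type F)].

Definition moduli (R : realType) (d n p : nat) (D : {set {set 'I_p}}) : Type :=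
  {C : set (cal_fan R d n p) | exists F, in_moduli D F /\
     C = [set F' | in_moduli D F' /\ cal_iso F F']}.

(* h (a, b) = a + hbar b on Z^d x Z^(n-d), with I_0 the first p indices in    *)
(* order and J the other ones; row j of hb is hbar (e_(d+j)).                 *)
Definition standard (R : realType) d n p (F : cal_fan R d n p)
    (hb : 'M[R]_(n - d, d)) : Prop :=
  [/\ forall (i : 'I_n) (j : 'I_d), i = j :> nat ->
        calib F (delta_mx 0 i) = delta_mx 0 j,
      forall (i : 'I_n) (j : 'I_(n - d)), i = (d + j)%N :> nat ->
        calib F (delta_mx 0 i) = row j hb,
      forall k : 'I_p, cidx F k = k :> nat &
      cvirt F = [set i : 'I_n | (p <= i)%N]%SET].

(* Quotient topology: for each labelled type E equivalent to D, the standard  *)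
(* fans of type E are parametrized by a subset of (R^d)^(n-d), and U is open  *)
(* when all its preimages under these parametrizations are relatively open.   *)
Definition moduli_open (R : realType) d n p (D : {set {set 'I_p}})
    (U : set (@moduli R d n p D)) : Prop :=
  forall (c : @moduli R d n p D) F (hb : 'M[R]_(n - d, d)),
    U c -> sval c F -> standard F hb ->
    nbhs hb [set hb' | forall (c' : @moduli R d n p D) F',
      sval c' F' -> standard F' hb' -> comb_type F' = comb_type F -> U c'].

Section ModuliTopology.
Variables (R : realType) (d n p : nat) (D : {set {set 'I_p}}).
Local Notation M := (@moduli R d n p D).

Lemma moduli_openT : moduli_open [set: M].
Proof. by move=> c F hb _ _ _; apply: filterE => hb' c' F' _ _ _. Qed.

Lemma moduli_openI : setI_closed (@moduli_open R d n p D).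
Proof.
move=> U V oU oV c F hb [Uc Vc] cF sF.
apply: filterS2 (oU c F hb Uc cF sF) (oV c F hb Vc cF sF).
move=> hb' hU hV c' F' c'F' sF' eF'.
by split; [exact: (hU c' F')|exact: (hV c' F')].
Qed.

Lemma moduli_open_bigU (I : Type) (f : I -> set M) :
  (forall i, moduli_open (f i)) -> moduli_open (\bigcup_i f i).
Proof.
move=> of_ c F hb [i _ fic] cF sF.
apply: filterS (of_ i c F hb fic cF sF).
by move=> hb' hf c' F' c'F' sF' eF'; exists i => //; exact: (hf c' F').
Qed.

HB.instance Definition _ := gen_eqMixin M.
HB.instance Definition _ := gen_choiceMixin M.
HB.instance Definition _ := @isOpenTopological.Build M
  (@moduli_open R d n p D) moduli_openT moduli_openI moduli_open_bigU.

End ModuliTopology.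

(******************************************************************************)
(* Smooth manifolds                                                           *)
(******************************************************************************)

Fixpoint Ck (R : realType) (k m l : nat) (U : set 'rV[R]_m)
    (f : 'rV[R]_m -> 'rV[R]_l) {struct k} : Prop :=
  if k is k'.+1 then
    (forall x, U x -> differentiable f x) /\
    (forall v : 'rV[R]_m, Ck k' U (fun x => 'D_v f x))
  else forall x, U x -> {for x, continuous f}.

Definition Cinf (R : realType) (m l : nat) (U : set 'rV[R]_m)
    (f : 'rV[R]_m -> 'rV[R]_l) : Prop := forall k, Ck k U f.

Record chart (R : realType) (T : topologicalType) (m : nat) := Chart {
  cdom : set T;
  ccod : set 'rV[R]_m;
  cto :> T -> 'rV[R]_m;
  cinv : 'rV[R]_m -> T;
  cdom_open : open cdom;
  ccod_open : open ccod;
  cto_cod : forall x, cdom x -> ccod (cto x);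
  cinv_dom : forall y, ccod y -> cdom (cinv y);
  ctoK : forall x, cdom x -> cinv (cto x) = x;
  cinvK : forall y, ccod y -> cto (cinv y) = y;
  cto_continuous : forall x, cdom x -> {for x, continuous cto};
  cinv_continuous : forall y, ccod y -> {for y, continuous cinv} }.

Record manifold (R : realType) := Manifold {
  mcarrier :> topologicalType;
  mdim : nat;
  mhausdorff : hausdorff_space mcarrier;
  msecond_countable : @second_countable mcarrier;
  matlas : set (chart R mcarrier mdim);
  matlas_cover : forall x, exists2 c, matlas c & cdom c x;
  matlas_compat : forall c c', matlas c -> matlas c' ->
    Cinf [set y | ccod c y /\ cdom c' (cinv c y)] (c' \o cinv c) }.

Definition smooth_at (R : realType) (S T : manifold R) (f : S -> T) (x : S) :
    Prop :=
  exists (c : chart R S (mdim S)) (c' : chart R T (mdim T)) W,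
    [/\ matlas c /\ matlas c',
        cdom c x /\ cdom c' (f x),
        open W /\ W (c x),
        forall y, W y -> ccod c y /\ cdom c' (f (cinv c y)) &
        Cinf W (c' \o f \o cinv c)].

Definition smooth (R : realType) (S T : manifold R) (f : S -> T) : Prop :=
  forall x, smooth_at f x.

(* Local diffeomorphism. *)
Definition etale (R : realType) (S T : manifold R) (f : S -> T) : Prop :=
  smooth f /\ forall x, exists U (g : T -> S),
    [/\ open U /\ U x, open (f @` U), forall y, U y -> g (f y) = y &
        forall z, (f @` U) z -> smooth_at g z].

Definition is_point (R : realType) (T : manifold R) : Prop :=
  exists t : T, forall s : T, s = t.

(******************************************************************************)
(* Stacks over the category of smooth manifolds                               *)
(******************************************************************************)

(* A category fibered in groupoids: fobj S is the class of objects over S and *)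
(* farr x y f the class of arrows from x to y over f (smooth by farr_smooth). *)
(* Composition is written in diagrammatic order. The laws typecheck because   *)
(* composition of functions is associative and unital up to conversion.       *)
Record fibered (R : realType) := Fibered {
  fobj : manifold R -> Type;
  farr : forall S T : manifold R, fobj S -> fobj T -> (S -> T) -> Type;
  farr_smooth : forall (S T : manifold R) (x : fobj S) (y : fobj T)
    (f : S -> T), farr x y f -> smooth f;
  fid : forall (S : manifold R) (x : fobj S), farr x x (fun s => s);
  fcomp : forall (S T V : manifold R) (x : fobj S) (y : fobj T) (z : fobj V)
    (f : S -> T) (g : T -> V),
    farr x y f -> farr y z g -> farr x z (fun s => g (f s));
  fcomp1l : forall (S T : manifold R) (x : fobj S) (y : fobj T) (f : S -> T)
    (a : farr x y f), fcomp (fid x) a = a;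
  fcomp1r : forall (S T : manifold R) (x : fobj S) (y : fobj T) (f : S -> T)
    (a : farr x y f), fcomp a (fid y) = a;
  fcompA : forall (S T V W : manifold R) (x : fobj S) (y : fobj T)
    (z : fobj V) (w : fobj W) (f : S -> T) (g : T -> V) (h : V -> W)
    (a : farr x y f) (b : farr y z g) (c : farr z w h),
    fcomp a (fcomp b c) = fcomp (fcomp a b) c;
  flift : forall (S T : manifold R) (f : S -> T), smooth f ->
    forall y : fobj T, exists x : fobj S, inhabited (farr x y f);
  fcartesian : forall (S T V : manifold R) (x : fobj S) (y : fobj T)
    (z : fobj V) (f : S -> T) (g : T -> V)
    (b : farr y z g) (c : farr x z (fun s => g (f s))), smooth f ->
    exists! a : farr x y f, fcomp a b = c }.

Definition open_cover (T : topologicalType) (C : set (set T)) : Prop :=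
  (forall U, C U -> open U) /\ (forall x, exists2 U, C U & U x).

(* The sieve generated by an open cover: the smooth maps into S that factor   *)
(* through some member of the cover.                                          *)
Definition in_sieve (R : realType) (S : manifold R) (C : set (set S))
    (T : manifold R) (f : T -> S) : Prop :=
  smooth f /\ exists2 U, C U & range f `<=` U.

(* Arrows from x to y over id_S form a sheaf: a family of arrows over the     *)
(* sieve, natural in the objects above its elements, comes from a unique one. *)
Definition glue_arrows (R : realType) (X : fibered R) : Prop :=
  forall (S : manifold R) (C : set (set S)) (x y : fobj X S), open_cover C ->
  forall (m : forall (T : manifold R) (z : fobj X T) (f : T -> S),
      in_sieve C f -> farr z x f -> farr z y f),
  (forall (T T' : manifold R) (z : fobj X T) (z' : fobj X T') (f : T -> S)
      (g : T' -> T) (hf : in_sieve C f) (hfg : in_sieve C (fun t => f (g t)))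
      (a : farr z x f) (b : farr z' z g),
    m T' z' _ hfg (fcomp b a) = fcomp b (m T z f hf a)) ->
  exists! u : farr x y (fun s => s),
    forall (T : manifold R) (z : fobj X T) (f : T -> S) (hf : in_sieve C f)
      (a : farr z x f), m T z f hf a = fcomp a u.

(* Descent data are effective: x is a functor from the sieve to X over the    *)
(* base category, and it must come from an object over S.                     *)
Definition glue_objects (R : realType) (X : fibered R) : Prop :=
  forall (S : manifold R) (C : set (set S)), open_cover C ->
  forall (x : forall (T : manifold R) (f : T -> S), in_sieve C f -> fobj X T)
    (r : forall (T T' : manifold R) (f : T -> S) (g : T' -> T)
        (hf : in_sieve C f) (hfg : in_sieve C (fun t => f (g t))),
      smooth g -> farr (x T' (fun t => f (g t)) hfg) (x T f hf) g),
  (forall (T : manifold R) (f : T -> S) (hf : in_sieve C f)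
      (h1 : smooth (fun t : T => t)),
    r T T f (fun t => t) hf hf h1 = fid (x T f hf)) ->
  (forall (T T' T'' : manifold R) (f : T -> S) (g : T' -> T) (g' : T'' -> T')
      (hf : in_sieve C f) (hfg : in_sieve C (fun t => f (g t)))
      (hfgg' : in_sieve C (fun t => f (g (g' t))))
      (hg : smooth g) (hg' : smooth g') (hgg' : smooth (fun t => g (g' t))),
    fcomp (r T' T'' (fun t => f (g t)) g' hfg hfgg' hg') (r T T' f g hf hfg hg)
      = r T T'' f (fun t => g (g' t)) hf hfgg' hgg') ->
  exists (y : fobj X S)
    (e : forall (T : manifold R) (f : T -> S) (hf : in_sieve C f),
      farr (x T f hf) y f),
    forall (T T' : manifold R) (f : T -> S) (g : T' -> T) (hf : in_sieve C f)
      (hfg : in_sieve C (fun t => f (g t))) (hg : smooth g),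
    fcomp (r T T' f g hf hfg hg) (e T f hf) = e T' (fun t => f (g t)) hfg.

Definition is_stack (R : realType) (X : fibered R) : Prop :=
  glue_arrows X /\ glue_objects X.

(******************************************************************************)
(* Orbifolds                                                                  *)
(******************************************************************************)

(* The arrow a : A -> X given by an object over A is representable, etale and *)
(* surjective: for every x over T, the triples (z, b : z -> x, b' : z -> a)   *)
(* have a terminal one, over a manifold P (which thus represents the fiber    *)
(* product of T and A over X), and P -> T is etale and surjective. Arrows     *)
(* over propositionally equal maps are compared in a sigma type.              *)
Definition etale_atlas (R : realType) (X : fibered R) (A : manifold R)
    (a : fobj X A) : Prop :=
  forall (T : manifold R) (x : fobj X T),
  exists (P : manifold R) (q : P -> T) (q' : P -> A) (w : fobj X P)
    (b : farr w x q) (b' : farr w a q'),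
    [/\ etale q, forall t, exists s, q s = t &
      forall (S : manifold R) (z : fobj X S) (f : S -> T) (f' : S -> A)
        (c : farr z x f) (c' : farr z a f'),
      exists! u : {h : S -> P & farr z w h},
        existT (fun k => farr z x k) _ (fcomp (projT2 u) b) = existT _ f c /\
        existT (fun k => farr z a k) _ (fcomp (projT2 u) b') = existT _ f' c'].

(* The isotropy group of a point x of X is the group of arrows from x to x    *)
(* over the identity.                                                         *)
Definition finite_isotropy (R : realType) (X : fibered R) : Prop :=
  forall (T : manifold R) (x : fobj X T), is_point T ->
    finite_set [set: farr x x (fun t => t)].

Record orbifold (R : realType) (m : nat) := Orbifold {
  ofib :> fibered R;
  ostack : is_stack ofib;
  oman : manifold R;
  oman_dim : mdim oman = m;
  oobj : fobj ofib oman;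
  oatlas : etale_atlas oobj;
  oisotropy : finite_isotropy ofib }.

(* kappa identifies M with the underlying topological space of X, that is the *)
(* set of isomorphism classes of points of X, with the finest topology making *)
(* all the maps T -> |X| induced by objects over manifolds T continuous.      *)
Definition underlying_space (R : realType) (X : fibered R)
    (M : topologicalType) (kappa : forall T : manifold R, fobj X T -> T -> M) :
    Prop :=
  [/\ forall (S T : manifold R) (x : fobj X S) (y : fobj X T) (f : S -> T),
        farr x y f -> forall s, kappa S x s = kappa T y (f s),
      forall (T : manifold R) (x y : fobj X T) (t : T), is_point T ->
        kappa T x t = kappa T y t -> inhabited (farr x y (fun s => s)),
      forall c : M, exists (T : manifold R) (x : fobj X T) (t : T),
        is_point T /\ kappa T x t = c &
      forall U : set M, open U <->
        forall (T : manifold R) (x : fobj X T), open (kappa T x @^-1` U)].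

Record orbifold_structure (R : realType) (M : topologicalType) (m : nat) :=
  OrbifoldStructure {
    sorb :> orbifold R m;
    skappa : forall T : manifold R, fobj sorb T -> T -> M;
    skappaP : underlying_space skappa }.

(* Main.v *)
(* A d-dimensional cone of D provides d generators that are linearly
   independent in every fan of type D. After relabelling they are the first d
   generators, and the linear group moves them to the standard basis, so that
   fans of type D up to linear isomorphism form a single open set W of
   (R^d)^(n-d): a family of vectors generates a simplicial fan of type D iff
   certain linear relations with sign conditions are trivial, which is an open
   condition by compactness. Two points of W are isomorphic iff they are
   related by the finite group G of the permutations of the n generators that
   preserve D; it acts on W by permuting the vectors and normalizing again, so
   by rational functions. Hence the moduli space is W / G and the orbifold is
   the quotient stack [W / G].

   A G-torsor over S with an equivariant map to W is encoded without its total
   space, by trivializing it pointwise: it becomes a possibly discontinuous map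
   w : S -> W with transition elements k(s0, s) of G, for s near s0, such that
   k(s0, s) w(s) is smooth in s and k satisfies the cocycle identity. An arrow
   is a function S -> G compatible with these data. *)

From HB Require Import structures.
Require Import Defs.
From mathcomp Require Import all_boot all_order all_algebra all_fingroup.
From mathcomp Require Import all_classical all_reals.
From mathcomp Require Import topology normedtype derive landau.

Set Implicit Arguments.
Unset Strict Implicit.
Unset Printing Implicit Defensive.

Import Order.TTheory GRing.Theory Num.Theory.
Import numFieldNormedType.Exports.

Local Open Scope classical_set_scope.
Local Open Scope ring_scope.

(** * Functions of class C^k *)

(** Descent data here are functors on a sieve tested on all manifolds, which is what makes the
    pointwise encoding of torsors useful. A point s of S is a map from the one-point manifold and
    lies in every covering sieve, so the value at s of a glued object or arrow can be read off
    there; only local compatibility is left, and it is checked on small charts. The price is paid at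
    the atlas: the fibre product of T with W over the stack is the total space of a torsor, which
    has to be rebuilt as a manifold from the transition elements.

    All n generators, virtual ones included, are the rows of a single matrix, so that an isomorphism
    of calibrated fans becomes an invertible matrix together with one permutation of n indices.
    Maximal length makes J the complement of I_0, hence a permutation that respects the types
    respects J as well.

    The quotient topology refers to standard fans of every labelled type, whereas W contains only
    one labelled type. A relabelling followed by normalization, which is rational on an open set,
    carries the other types to W. *)

Lemma near_eq_differentiable (R : realType) (V W : normedModType R)
    (f g : V -> W) (x : V) :
  (\forall y \near x, f y = g y) -> differentiable f x -> differentiable g x.
Proof.
move=> fg /diff_locallyP[dc dE].
have gE : g \o shift x = cst (g x) + 'd f x +o_ 0 id.
  apply/eqaddoP => e e0; move/eqaddoP : dE => /(_ _ e0) dE.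
  move: (fg); rewrite (near_shift 0) subr0 => fg'.
  apply: filterS2 dE fg' => h /= + fh.
  by rewrite !fctE /= in fh *; rewrite -(nbhs_singleton fg) -fh.
apply/diff_locallyP.
suff -> : 'd g x = 'd f x :> (V -> W) by [].
by apply: diff_unique.
Qed.

Lemma near_eq_continuous (T T' : topologicalType) (f g : T -> T') (x : T) :
  (\forall y \near x, f y = g y) -> {for x, continuous f} ->
  {for x, continuous g}.
Proof.
move=> fg cf; rewrite /prop_for /continuous_at -(nbhs_singleton fg).
by apply: cvg_trans cf; apply: near_eq_cvg.
Qed.

Lemma open_near_eq (X : topologicalType) (T : Type) (U : set X) (f g : X -> T)
    x : open U -> (forall y, U y -> f y = g y) -> U x ->
  \forall y \near x, f y = g y.
Proof. by move=> oU fg Ux; apply: filterS fg _; exact: open_nbhs_nbhs. Qed.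

Lemma open_capP (X Y : topologicalType) (U : set X) (Z : set Y) (f : X -> Y) :
  open U -> (forall x, U x -> {for x, continuous f}) -> open Z ->
  open [set x | U x /\ Z (f x)].
Proof.
rewrite !openE => oU cf oZ x [Ux Zx].
by apply: filterI; [exact: oU|exact: (cf x Ux _ (oZ _ Zx))].
Qed.

Lemma mx_continuous (R : realType) (T : topologicalType) m n
    (f : T -> 'M[R]_(m, n)) x :
  (forall i j, {for x, continuous (fun y => f y i j)}) ->
  {for x, continuous f}.
Proof.
move=> cf A [P fP PA]; rewrite nbhs_simpl /=.
have : \forall y \near x, forall ij : 'I_m * 'I_n, P ij.1 ij.2 (f y ij.1 ij.2).
  by apply: filter_forall => -[i j]; exact: cf.
by apply: filterS => y Py; apply: PA => i j; exact: (Py (i, j)).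
Qed.

(** * Real-valued functions of class C^k *)

Section ScalarCk.
Variables (R : realType) (m : nat).
Implicit Types (U V : set 'rV[R]_m) (f g : 'rV[R]_m -> R).

(** Scalar counterpart of [Ck]: products and inverses are formed in R, and [CkP] transfers the
    results to vector-valued maps coordinate by coordinate. *)
Fixpoint Ckr k U f : Prop :=
  if k is k'.+1 then
    (forall x, U x -> differentiable f x) /\
    (forall v : 'rV[R]_m, Ckr k' U (fun x => 'D_v f x))
  else forall x, U x -> {for x, continuous f}.

Lemma Ckr_ext k U f g : open U -> (forall x, U x -> f x = g x) ->
  Ckr k U f -> Ckr k U g.
Proof.
move=> oU; elim: k f g => [|k IH] f g fg /=.
  move=> cf x Ux; apply: near_eq_continuous (cf x Ux).
  exact: open_near_eq fg Ux.
move=> [df Df]; split=> [x Ux|v].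
  apply: near_eq_differentiable (df x Ux); exact: open_near_eq fg Ux.
apply: IH (Df v) => x Ux; apply: near_eq_derive; exact: open_near_eq fg Ux.
Qed.

Lemma CkrS k U f : Ckr k.+1 U f -> Ckr k U f.
Proof.
elim: k f => [|k IH] f [df Df].
  by move=> x Ux; exact/differentiable_continuous/df.
by split=> // v; exact: IH.
Qed.

Lemma Ckr_continuous k U f x : Ckr k U f -> U x -> {for x, continuous f}.
Proof. by elim: k => [|k IH] /=; [apply|move=> /CkrS]. Qed.

Lemma Ckr_cst k U c : Ckr k U (fun=> c).
Proof.
elim: k c => [|k IH] c /=; first by move=> x _; exact: cst_continuous.
split=> [x _|v]; first exact: differentiable_cst.
by under eq_fun do rewrite derive_cst; exact: IH.
Qed.

Lemma CkrD k U f g : open U -> Ckr k U f -> Ckr k U g ->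
  Ckr k U (fun x => f x + g x).
Proof.
move=> oU; elim: k f g => [|k IH] f g.
  by move=> cf cg x Ux; exact: (@continuousD _ _ _ f g x (cf x Ux) (cg x Ux)).
move=> [df Df] [dg Dg]; split=> [x Ux|v].
  by apply: differentiableD; [exact: df|exact: dg].
apply: Ckr_ext (IH _ _ (Df v) (Dg v)) => // x Ux.
by rewrite deriveD //; apply: diff_derivable; [exact: df|exact: dg].
Qed.

Lemma CkrM k U f g : open U -> Ckr k U f -> Ckr k U g ->
  Ckr k U (fun x => f x * g x).
Proof.
move=> oU; elim: k f g => [|k IH] f g.
  by move=> cf cg x Ux; exact: (@continuousM _ _ f g x (cf x Ux) (cg x Ux)).
move=> Cf Cg; have [df Df] := Cf; have [dg Dg] := Cg; split=> [x Ux|v].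
  by apply: differentiableM; [exact: df|exact: dg].
have := CkrD oU (IH _ _ (CkrS Cf) (Dg v)) (IH _ _ (CkrS Cg) (Df v)).
apply: Ckr_ext => // x Ux.
by rewrite deriveM //; apply: diff_derivable; [exact: df|exact: dg].
Qed.

Lemma Ckr_sum k U (I : Type) (r : seq I) (P : pred I)
    (f : I -> 'rV[R]_m -> R) : open U ->
  (forall i, Ckr k U (f i)) -> Ckr k U (fun x => \sum_(i <- r | P i) f i x).
Proof.
move=> oU Cf; elim: r => [|i r IH].
  by under eq_fun do rewrite big_nil; exact: Ckr_cst.
under eq_fun do rewrite big_cons; case: (P i) => //.
exact: CkrD.
Qed.

Lemma Ckr_prod k U (I : Type) (r : seq I) (P : pred I)
    (f : I -> 'rV[R]_m -> R) : open U ->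
  (forall i, Ckr k U (f i)) -> Ckr k U (fun x => \prod_(i <- r | P i) f i x).
Proof.
move=> oU Cf; elim: r => [|i r IH].
  by under eq_fun do rewrite big_nil; exact: Ckr_cst.
under eq_fun do rewrite big_cons; case: (P i) => //.
exact: CkrM.
Qed.

(** The derivative of 1/f is -(1/f)^2 times that of f, so the induction hypothesis is applied to 1/f
    itself, one order lower. *)
Lemma CkrV k U f : open U -> (forall x, U x -> f x != 0) -> Ckr k U f ->
  Ckr k U (fun x => (f x)^-1).
Proof.
move=> oU f0; elim: k f f0 => [|k IH] f f0.
  by move=> cf x Ux; exact: (@continuousV _ _ f x (f0 x Ux) (cf x Ux)).
move=> Cf; have [df Df] := Cf; split=> [x Ux|v].
  by apply: differentiableV; [exact: df|exact: f0].
have CV := IH _ f0 (CkrS Cf).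
have := CkrM oU (Ckr_cst k U (-1)) (CkrM oU (CkrM oU CV CV) (Df v)).
apply: Ckr_ext => // x Ux.
rewrite deriveV ?f0 //; last by apply: diff_derivable; exact: df.
set D := 'D_v f x.
by rewrite [RHS]mulNr mulN1r expr2 invfM.
Qed.

Lemma Ckr_coord k U (j : 'I_m) : Ckr k U (fun x => x 0 j).
Proof.
case: k => [|k]; first by move=> x _; exact: coord_continuous.
split=> [x _|v]; first exact: differentiable_coord.
have -> : (fun x : 'rV[R]_m => 'D_v (fun y : 'rV[R]_m => y 0 j) x) = fun=> v 0 j.
  apply/funext => x.
  have := derive_mx (@derivable_id _ _ x v); rewrite derive_id.
  by move/rowP => /(_ j); rewrite mxE.
exact: Ckr_cst.
Qed.

End ScalarCk.

(** * Vector-valued functions of class C^k *)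

Section VectorCk.
Variables (R : realType) (m : nat).
Implicit Types (U : set 'rV[R]_m).

Lemma differentiable_rVP l (f : 'rV[R]_m -> 'rV[R]_l) x :
  differentiable f x <-> forall j, differentiable (fun y => f y 0 j) x.
Proof.
split=> [df j|df].
  exact: (@differentiable_comp _ _ _ _ f (fun y : 'rV[R]_l => y 0 j) x df
    (differentiable_coord _ _ _)).
have -> : f = \sum_(j < l) (fun y => f y 0 j *: (delta_mx 0 j : 'rV[R]_l)).
  by apply/funext => y; rewrite fct_sumE -row_sum_delta.
by apply: differentiable_sum => j; exact/differentiableZl/df.
Qed.

Lemma CkP l k U (f : 'rV[R]_m -> 'rV[R]_l) : open U ->
  Ck k U f <-> forall j, Ckr k U (fun x => f x 0 j).
Proof.
move=> oU; elim: k f => [|k IH] f /=.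
  split=> [cf j x Ux|cf x Ux].
    exact: (continuous_comp (cf x Ux) (@coord_continuous _ _ _ _ _ _)).
  by apply: mx_continuous => i j; rewrite ord1; exact: cf.
have E v x j : differentiable f x ->
    'D_v f x 0 j = 'D_v (fun y => f y 0 j) x.
  move=> df; rewrite derive_mx; last exact: diff_derivable.
  by rewrite mxE.
split=> [[df Df] j|H].
  split=> [x Ux|v]; first by move: j; apply/differentiable_rVP/df.
  have /IH/(_ j) := Df v; apply: Ckr_ext => // x Ux.
  by rewrite E //; exact: df.
have df x : U x -> differentiable f x.
  by move=> Ux; apply/differentiable_rVP => j; have [+ _] := H j; apply.
split=> // v; apply/IH => j.
have [_ /(_ v)] := H j; apply: Ckr_ext => // x Ux.
by rewrite E //; exact: df.
Qed.

Lemma Ck_ext l k U (f g : 'rV[R]_m -> 'rV[R]_l) : open U ->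
  (forall x, U x -> f x = g x) -> Ck k U f -> Ck k U g.
Proof.
move=> oU fg /(CkP _ _ oU) Cf; apply/(CkP _ _ oU) => j.
by apply: Ckr_ext (Cf j) => // x Ux; rewrite fg.
Qed.

Lemma Ck_sub l k U U' (f : 'rV[R]_m -> 'rV[R]_l) : U' `<=` U ->
  Ck k U f -> Ck k U' f.
Proof.
move=> U'U; elim: k f => [|k IH] f /=; first by move=> cf x /U'U; exact: cf.
by move=> [df Df]; split=> [x /U'U|v]; [exact: df|exact/IH/Df].
Qed.

Lemma Ck_continuous l k U (f : 'rV[R]_m -> 'rV[R]_l) x : open U ->
  Ck k U f -> U x -> {for x, continuous f}.
Proof.
move=> oU /(CkP _ _ oU) Cf Ux; apply: mx_continuous => i j; rewrite ord1.
exact: Ckr_continuous (Cf j) Ux.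
Qed.

End VectorCk.

(** Chain rule in coordinates: the derivative of g o f along v is the sum over j of the j-th
    coordinate of the derivative of f times the j-th partial derivative of g composed with f. The
    induction hypothesis applies to each of the latter. *)
Lemma Ckr_comp (R : realType) m l k (U : set 'rV[R]_m) (V : set 'rV[R]_l)
    (f : 'rV[R]_m -> 'rV[R]_l) (g : 'rV[R]_l -> R) : open U -> open V ->
  (forall x, U x -> V (f x)) -> Ck k U f -> Ckr k V g -> Ckr k U (g \o f).
Proof.
move=> oU oV fUV; elim: k f fUV g => [|k IH] f fUV g.
  move=> cf cg x Ux; exact: continuous_comp (cf x Ux) (cg _ (fUV x Ux)).
move=> Cf Cg; have [df Df] := Cf; have [dg Dg] := Cg; split=> [x Ux|v].
  exact: differentiable_comp (df x Ux) (dg _ (fUV x Ux)).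
have Cf' : Ck k U f by apply/CkP => // j; apply: CkrS; move: j; exact/CkP.
have C j : Ckr k U (fun x => 'D_v f x 0 j * 'D_(delta_mx 0 j) g (f x)).
  have /(CkP _ _ oU)/(_ j) CD := Df v.
  by apply: CkrM => //; exact: IH (Dg _).
apply: Ckr_ext (Ckr_sum (index_enum _) xpredT oU C) => // x Ux.
have dfx := df x Ux; have dgx := dg _ (fUV x Ux).
have -> : 'D_v (g \o f) x = 'd g (f x) ('D_v f x).
  rewrite (deriveE v (differentiable_comp dfx dgx)) (diff_comp dfx dgx) /=.
  by rewrite (deriveE v dfx).
rewrite [in RHS](row_sum_delta ('D_v f x)) linear_sum.
by apply: eq_bigr => j _; rewrite linearZ (deriveE _ dgx).
Qed.

Lemma Cinf_comp (R : realType) m l r (U : set 'rV[R]_m) (V : set 'rV[R]_l)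
    (f : 'rV[R]_m -> 'rV[R]_l) (g : 'rV[R]_l -> 'rV[R]_r) : open U -> open V ->
  (forall x, U x -> V (f x)) -> Cinf U f -> Cinf V g -> Cinf U (g \o f).
Proof.
move=> oU oV fUV Cf Cg k; apply/CkP => // j.
have /(CkP _ _ oV)/(_ j) := Cg k; exact: (Ckr_comp oU oV fUV (Cf k)).
Qed.

Lemma Cinf_id (R : realType) m (U : set 'rV[R]_m) : open U -> Cinf U id.
Proof. by move=> oU k; apply/CkP => // j; exact: Ckr_coord. Qed.

Lemma Cinf_ext (R : realType) m l (U : set 'rV[R]_m)
    (f g : 'rV[R]_m -> 'rV[R]_l) : open U ->
  (forall x, U x -> f x = g x) -> Cinf U f -> Cinf U g.
Proof. by move=> oU fg Cf k; exact: Ck_ext fg (Cf k). Qed.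

Lemma Cinf_sub (R : realType) m l (U U' : set 'rV[R]_m)
    (f : 'rV[R]_m -> 'rV[R]_l) : U' `<=` U -> Cinf U f -> Cinf U' f.
Proof. by move=> U'U Cf k; exact: Ck_sub (Cf k). Qed.

Lemma Cinf_continuous (R : realType) m l (U : set 'rV[R]_m)
    (f : 'rV[R]_m -> 'rV[R]_l) x : open U ->
  Cinf U f -> U x -> {for x, continuous f}.
Proof. by move=> oU Cf; exact: Ck_continuous (Cf 0%N). Qed.

(** * Smooth maps and open submanifolds *)

Lemma Cinf_cst (R : realType) m l (U : set 'rV[R]_m) (a : 'rV[R]_l) :
  open U -> Cinf U (fun=> a).
Proof. by move=> oU k; apply/CkP => // j; exact: Ckr_cst. Qed.

Lemma chart_capP (R : realType) (T : topologicalType) m (c : chart R T m)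
    (Z : set T) : open Z -> open [set y | ccod c y /\ Z (cinv c y)].
Proof.
move=> oZ.
apply: (@open_capP _ _ _ _ (cinv c) (@ccod_open _ _ _ c) _ oZ) => y.
exact: cinv_continuous.
Qed.

(** * Locality and composition of smooth maps *)

Section SmoothAt.
Variable R : realType.
Implicit Types S T V : manifold R.

Lemma smooth_at_near S T (f g : S -> T) x :
  (\forall y \near x, f y = g y) -> smooth_at f x -> smooth_at g x.
Proof.
rewrite /prop_near1 nbhsE => -[N [oN Nx] fg].
move=> [c [c' [W [[cS c'T] [cx c'fx] [oW Wx] WP fC]]]].
pose W' := [set y | W y /\ [set y | ccod c y /\ N (cinv c y)] y].
have oW' : open W' by exact: (openI oW (@chart_capP _ _ _ c _ oN)).
exists c, c', W'; split => //.
- by rewrite -(fg x Nx).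
- by split => //; split => //; split; [exact: cto_cod|rewrite /= ctoK].
- by move=> y [Wy [cy /fg Ny]]; rewrite -Ny; exact: WP.
- apply: (@Cinf_ext _ _ _ _ (c' \o f \o cinv c)) => //.
    by move=> y [_ [_ /fg /= ->]].
  by apply: Cinf_sub fC => y [].
Qed.

Lemma smooth_at_continuous S T (f : S -> T) x :
  smooth_at f x -> {for x, continuous f}.
Proof.
move=> [c [c' [W [[cS c'T] [cx c'fx] [oW Wx] WP fC]]]].
have fc : {for x, continuous (cinv c' \o (c' \o f \o cinv c) \o c)}.
  apply: (@continuous_comp _ _ _ c); first exact: cto_continuous.
  apply: (@continuous_comp _ _ _ (c' \o f \o cinv c)).
    exact: Cinf_continuous fC Wx.
  by apply: cinv_continuous; apply: cto_cod; rewrite /= ctoK.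
apply: near_eq_continuous fc.
have : \forall y \near x, W (c y).
  by apply: (cto_continuous cx); exact: open_nbhs_nbhs.
apply: filterS2 (open_nbhs_nbhs (conj (@cdom_open _ _ _ c) cx)) => y cy Wy /=.
by have [_ +] := WP _ Wy; rewrite ctoK // => ?; rewrite ctoK.
Qed.

Lemma smooth_at_nearby S T (f : S -> T) x :
  smooth_at f x -> \forall y \near x, smooth_at f y.
Proof.
move=> [c [c' [W [[cS c'T] [cx c'fx] [oW Wx] WP fC]]]].
have : \forall y \near x, W (c y).
  by apply: (cto_continuous cx); exact: open_nbhs_nbhs.
apply: filterS2 (open_nbhs_nbhs (conj (@cdom_open _ _ _ c) cx)) => y cy Wy /=.
exists c, c', W; split => //; split => //.
by have [_ +] := WP _ Wy; rewrite ctoK.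
Qed.

(** The charts that witness smoothness of f and of g need not agree around f x; the transition map
    between them is inserted, and [matlas_compat] makes it smooth. *)
Lemma smooth_at_comp S T V (f : S -> T) (g : T -> V) x :
  smooth_at f x -> smooth_at g (f x) -> smooth_at (fun y => g (f y)) x.
Proof.
move=> [c [c' [W [[cS c'T] [cx c'fx] [oW Wx] WP fC]]]].
move=> [e [e' [W2 [[eT e'V] [efx e'gx] [oW2 W2x] W2P gC]]]].
(* The part of the chart c' on which the change to the chart e is defined and lands in W2. *)
pose Z := [set z | [set z | ccod c' z /\ cdom e (cinv c' z)] z /\
                   W2 ((e \o cinv c') z)].
have oZ' := @chart_capP _ _ _ c' _ (@cdom_open _ _ _ e).
have c'e := matlas_compat c'T eT.
have oZ : open Z.
  apply: (@open_capP _ _ _ _ (e \o cinv c') oZ' _ oW2) => z /= Zz.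
  exact: Cinf_continuous c'e Zz.
pose W3 := [set y | W y /\ Z ((c' \o f \o cinv c) y)].
have oW3 : open W3.
  apply: (@open_capP _ _ _ _ (c' \o f \o cinv c) oW _ oZ) => y Wy.
  exact: Cinf_continuous fC Wy.
exists c, e', W3; split => //.
- split=> //; split => //; rewrite /Z /= ctoK //; split.
    by split; [exact: cto_cod|rewrite ctoK].
  by rewrite /= ctoK.
- move=> y [Wy [[]]] /=; have [cy fy] := WP _ Wy; rewrite ctoK // => _ efy W2y.
  by split=> //; have [_ ] := W2P _ W2y; rewrite ctoK.
- have C1 : Cinf W3 ((e \o cinv c') \o (c' \o f \o cinv c)).
    apply: (@Cinf_comp _ _ _ _ _ [set y | ccod c' y /\ cdom e (cinv c' y)]) => //.
      by move=> y [_ []].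
    by apply: Cinf_sub fC => y [].
  have C2 := Cinf_comp oW3 oW2 _ C1 gC.
  have {C2} := C2 (fun y (H : W3 y) => let: conj _ (conj _ H2) := H in H2).
  apply: Cinf_ext => // y [Wy [[]]] /=.
  by have [cy fy] := WP _ Wy; rewrite ctoK // => _ efy _; rewrite ctoK.
Qed.

Lemma smooth_comp S T V (f : S -> T) (g : T -> V) :
  smooth f -> smooth g -> smooth (fun y => g (f y)).
Proof. by move=> sf sg x; apply: smooth_at_comp. Qed.

Lemma smooth_at_cst S T (t : T) (x : S) : smooth_at (fun=> t) x.
Proof.
have [c cS cx] := matlas_cover x; have [c' cT ct] := matlas_cover t.
exists c, c', (ccod c); split => //; first by split; [exact: ccod_open|exact: cto_cod].
by apply: Cinf_cst; exact: ccod_open.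
Qed.

Lemma smooth_at_id S (x : S) : smooth_at (fun y : S => y) x.
Proof.
have [c cS cx] := matlas_cover x.
exists c, c, (ccod c); split => //.
- by split; [exact: ccod_open|exact: cto_cod].
- by move=> y cy; split => //; exact: cinv_dom.
- have oc := @ccod_open _ _ _ c.
  apply: (@Cinf_ext _ _ _ _ id) => //; last exact: Cinf_id.
  by move=> y cy /=; rewrite cinvK.
Qed.

Lemma smooth_continuous S T (f : S -> T) : smooth f -> continuous f.
Proof. by move=> sf x; exact: smooth_at_continuous. Qed.

End SmoothAt.

(** * Second countability of subsets of R^m *)

Section SecondCountable.
Variable R : realType.

Lemma nbhs_set_typeP (X : topologicalType) (V : set X) (x : V) (A : set V) :
  nbhs x A <-> \forall y \near set_val x, forall Vy : y \in V, A (exist _ y Vy).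
Proof.
split.
  rewrite nbhsE => -[B [[C oC <-] /= Cx] CA].
  by apply: filterS (open_nbhs_nbhs (conj oC Cx)) => y Cy Vy; apply: CA.
rewrite /prop_near1 nbhsE => -[B [oB Bx] BA].
rewrite nbhsE; exists (set_val @^-1` B) => //=; first by split => //; exists B.
by move=> [y Vy] By; exact: BA.
Qed.

(** The basis consists of the traces of balls with rational centre and radius: if r < e / 2 and the
    centre is within r of x, the ball of radius r contains x and stays within e of x. *)
Lemma rV_set_second_countable m (V : set 'rV[R]_m) : @second_countable V.
Proof.
pose b (qr : 'rV[rat]_m * rat) : set V :=
  set_val @^-1` (ball (map_mx ratr qr.1 : 'rV[R]_m) (ratr qr.2 : R)).
exists (range b).
  exact: (sub_countable (card_image_le b setT) (countableP _)).
split.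
  move=> _ [qr _ <-]; eexists; last by [].
  exact: ball_open.
move=> x A /nbhs_set_typeP /nbhs_ballP[e /= e0 xA].
have [r] := @rat_in_itvoo R 0 (e / 2) (divr_gt0 e0 (ltr0n _ 2)).
rewrite in_itv /= => /andP[r0 re].
have /choice[q qP] : forall j, exists q : rat, `|ratr q - set_val x 0 j| < ratr r.
  move=> j; have [|q] := @rat_in_itvoo R (set_val x 0 j - ratr r)
     (set_val x 0 j + ratr r).
    by rewrite ltrBlDr -addrA ltrDl addr_gt0.
  by rewrite in_itv /= -ltr_distlC distrC; exists q.
exists (b (\row_j q j, r)).
  split; first by exists (\row_j q j, r).
  by split => // i j; rewrite ord1 !mxE; exact: qP.
move=> [y Vy] [_ /= yP]; apply: xA; split => // i j.
have := yP i j; rewrite ord1 !mxE /ball /= => qy.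
rewrite -[X in X - _](subrK (ratr (q j))) -addrA (le_lt_trans (ler_normD _ _)) //.
rewrite (splitr e) ltrD ?(lt_trans _ re)//.
by rewrite distrC; exact: qP.
Qed.

End SecondCountable.

(** * Open subsets of R^m as manifolds *)

Section OpenSubset.
Variables (R : realType) (m : nat) (V : set 'rV[R]_m).
Hypothesis oV : open V.

(** The charts are given by a property because [cinv] needs some value outside V, and there is none
    to choose when V is empty. [open_atlas_cover] uses the point to be covered as that value. *)
Definition open_atlas : set (chart R V m) :=
  [set c | [/\ cdom c = setT, ccod c = V & forall x, c x = set_val x]].

Lemma open_atlas_cover (x : V) : exists2 c, open_atlas c & cdom c x.
Proof.
pose inv y : V := if pselect (V y) is left Vy then exist _ y (mem_set Vy) else x.
have invE y (Vy : V y) : inv y = exist _ y (mem_set Vy).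
  rewrite /inv; case: pselect => // Vy'; exact: eq_exist.
have cto_cod_ (y : V) : setT y -> V (set_val y) by move=> _; exact: set_valP.
have ctoK_ (y : V) : setT y -> inv (set_val y) = y.
  move=> _; rewrite (invE _ (set_valP y)); exact: val_inj.
have cinvK_ y : V y -> set_val (inv y) = y by move=> Vy; rewrite (invE y Vy).
have cto_cont (y : V) : setT y -> {for y, continuous (set_val : V -> _)}.
  move=> _; exact: initial_continuous.
have cinv_cont y : V y -> {for y, continuous inv}.
  move=> Vy A; rewrite (invE y Vy) => /nbhs_set_typeP /= VA; rewrite nbhs_simpl /=.
  move: VA; apply: filterS2 (open_nbhs_nbhs (conj oV Vy)) => z Vz Az.
  by rewrite /= (invE z Vz).
exists (@Chart R V m setT V set_val inv openT oV cto_cod_ (fun _ _ => I)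
  ctoK_ cinvK_ cto_cont cinv_cont) => //.
Qed.

Lemma open_atlas_compat (c c' : chart R V m) : open_atlas c -> open_atlas c' ->
  Cinf [set y | ccod c y /\ cdom c' (cinv c y)] (c' \o cinv c).
Proof.
move=> [c1 c2 c3] [c1' c2' c3'].
have E : [set y | ccod c y /\ cdom c' (cinv c y)] = V.
  by apply/seteqP; split => y; rewrite /= c2 c1'; [case|].
rewrite E; apply: (@Cinf_ext _ _ _ _ id) => //; last exact: Cinf_id.
by move=> y Vy /=; rewrite c3' -c3 cinvK // c2.
Qed.

Lemma set_hausdorff : hausdorff_space V.
Proof.
move=> x y xy; apply/val_inj/norm_hausdorff => A B xA yB.
have vA : nbhs x (set_val @^-1` A) by exact: initial_continuous.
have vB : nbhs y (set_val @^-1` B) by exact: initial_continuous.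
by have [z [Az Bz]] := xy _ _ vA vB; exists (set_val z).
Qed.

Definition open_manifold : manifold R := Manifold set_hausdorff
  (rV_set_second_countable V) open_atlas_cover open_atlas_compat.

Lemma smooth_from_open (T : manifold R) (f : open_manifold -> T)
    (x : open_manifold) (c' : chart R T (mdim T)) W F :
  matlas c' -> open W -> W `<=` V -> W (set_val x) ->
  (forall y : open_manifold, W (set_val y) ->
    cdom c' (f y) /\ c' (f y) = F (set_val y)) ->
  Cinf W F -> smooth_at f x.
Proof.
move=> c'T oW WV Wx WF FC; have [c cV cx] := @matlas_cover _ open_manifold x.
have [c1 c2 c3] := cV.
have cinvE y : W y -> set_val (cinv c y) = y.
  by move=> /WV Vy; rewrite -c3 cinvK // c2.
exists c, c', W; split => //.
- by split => //; have [] := WF x Wx.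
- by rewrite /= c3.
- move=> y Wy; rewrite c2; split; first exact: WV.
  by have [] := WF (cinv c y); rewrite ?cinvE.
- apply: Cinf_ext FC => // y Wy /=.
  by have [] := WF (cinv c y); rewrite ?cinvE.
Qed.

Lemma smooth_to_open (S : manifold R) (f : S -> open_manifold) (x : S)
    (c : chart R S (mdim S)) W :
  matlas c -> cdom c x -> open W -> W (c x) -> W `<=` ccod c ->
  Cinf W (fun y => set_val (f (cinv c y))) -> smooth_at f x.
Proof.
move=> cS cx oW Wx WV fC; have [c' cV cfx] := @matlas_cover _ open_manifold (f x).
have [c1 c2 c3] := cV.
exists c, c', W; split => //; first by move=> y /WV; rewrite c1.
by apply: Cinf_ext fC => // y Wy /=; rewrite c3.
Qed.

End OpenSubset.

(* An open embedding of a manifold onto a neighbourhood of s0 contained in U.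
   The test objects of a sieve are manifolds mapping into S, so that these
   embeddings play the role of the open subsets of S. *)
Record small_chart (R : realType) (S : manifold R) (U : set S) (s0 : S) :=
  SmallChart {
    sc_man : manifold R;
    sc_map : sc_man -> S;
    sc_inv : S -> sc_man;
    sc_smooth : smooth sc_map;
    sc_range : range sc_map `<=` U;
    sc_center : sc_map (sc_inv s0) = s0;
    sc_mapK : forall t, sc_inv (sc_map t) = t;
    sc_inv_smooth : forall t, smooth_at sc_inv (sc_map t);
    sc_invK : forall t, \forall s \near sc_map t, sc_map (sc_inv s) = s }.

Arguments sc_smooth {R S U s0} s.
Arguments sc_range {R S U s0} s.
Arguments sc_center {R S U s0} s.
Arguments sc_mapK {R S U s0} s t.
Arguments sc_inv_smooth {R S U s0} s t.
Arguments sc_invK {R S U s0} s t.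

Lemma small_chartP (R : realType) (S : manifold R) (U : set S) (s0 : S) :
  open U -> U s0 -> inhabited (small_chart U s0).
Proof.
move=> oU Us0; have [c cS cs0] := matlas_cover s0.
pose V := [set y | ccod c y /\ U (cinv c y)].
have oV : open V := @chart_capP _ _ _ c _ oU.
have Vs0 : V (c s0) by split; [exact: cto_cod|rewrite /= ctoK].
pose f (y : open_manifold oV) : S := cinv c (set_val y).
(* The value where c s leaves V is arbitrary: only the germs of [b] along the range of [f]
   matter. *)
pose b (s : S) : open_manifold oV :=
  if pselect (V (c s)) is left Vs then exist _ (c s) (mem_set Vs)
  else exist _ (c s0) (mem_set Vs0).
have Vf (y : open_manifold oV) : V (set_val y) by exact: set_valP.
have fK y : c (f y) = set_val y by rewrite /f cinvK //; have [] := Vf y.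
have bE s : V (c s) -> set_val (b s) = c s by rewrite /b; case: pselect.
have cf y : cdom c (f y) by apply: cinv_dom; have [] := Vf y.
have mapK y : b (f y) = y by apply: val_inj; rewrite -[LHS]/(set_val (b (f y))) bE fK.
split; apply: (@SmallChart _ _ _ _ (open_manifold oV) f b) => //.
- move=> y; apply: (@smooth_from_open _ _ _ oV S f y c V id) => //.
  exact: Cinf_id.
- by move=> _ [y _ <-]; have [] := Vf y.
- by rewrite /f bE // ctoK.
- move=> y; apply: (@smooth_to_open _ _ _ oV S b _ c V) => //.
  + by rewrite fK.
  + by move=> z [].
  + apply: (@Cinf_ext _ _ _ _ id) => //; last exact: Cinf_id.
    by move=> z Vz /=; rewrite bE ?cinvK //; case: Vz.
- move=> y; have : \forall s \near f y, V (c s).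
    by apply: (cto_continuous (cf y)); rewrite fK; exact: open_nbhs_nbhs.
  apply: filterS2 (open_nbhs_nbhs (conj (@cdom_open _ _ _ c) (cf y))) => s cs Vs.
  by rewrite /f bE // ctoK.
Qed.

Definition point_manifold (R : realType) : manifold R :=
  open_manifold (@openT 'rV[R]_0).

Definition pt (R : realType) : point_manifold R := exist _ 0 (mem_set I).

Lemma is_point_manifold (R : realType) : is_point (point_manifold R).
Proof. by exists (pt R) => s; apply/val_inj/rowP => -[]. Qed.

(** * The stack quotient of a manifold by a finite group *)

Lemma near_continuous (X Y : topologicalType) (f : X -> Y) x (P : Y -> Prop) :
  {for x, continuous f} -> (\forall y \near f x, P y) ->
  \forall z \near x, P (f z).
Proof. by move=> cf fP; exact: cf. Qed.

Section QuotientStack.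
Variables (R : realType) (A : manifold R) (gT : finGroupType).
Variable act : gT -> A -> A.
Hypothesis act1 : forall x, act 1%g x = x.
Hypothesis actM : forall g h x, act (g * h)%g x = act g (act h x).
Hypothesis act_smooth : forall g, smooth (act g).
Implicit Types S T V W : manifold R.

(** In the cocycle identity the neighbourhood of s1 may depend on s1. This form pulls back along any
    continuous map and avoids choosing a domain for [qtr s0], whose values far from s0 carry no
    meaning. *)
Record qobj (S : manifold R) := QObj {
  qmap : S -> A;
  qtr : S -> S -> gT;
  qtrM : forall s0, \forall s1 \near s0, \forall s \near s1,
    qtr s0 s = (qtr s0 s1 * qtr s1 s)%g;
  qsmooth : forall s0, smooth_at (fun s => act (qtr s0 s) (qmap s)) s0 }.

(** The last clause says that [e] is locally constant once read in the local trivializations that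
    [qtr] provides around s0 and f s0. *)
Definition qarrP (S T : manifold R) (x : qobj S) (y : qobj T) (f : S -> T)
    (e : S -> gT) : Prop :=
  [/\ smooth f, forall s, act (e s) (qmap x s) = qmap y (f s) &
    forall s0, \forall s \near s0,
      (qtr y (f s0) (f s) * e s = e s0 * qtr x s0 s)%g].

Definition qarr S T (x : qobj S) (y : qobj T) (f : S -> T) : Type :=
  {e | qarrP x y f e}.

Lemma qarr_inj S T (x : qobj S) (y : qobj T) (f : S -> T) (a b : qarr x y f) :
  sval a =1 sval b -> a = b.
Proof. by case: a b => [e p] [e' p'] /= ab; apply: eq_exist; exact/funext. Qed.

Lemma qtr1 S (x : qobj S) s : qtr x s s = 1%g.
Proof.
have /nbhs_singleton/nbhs_singleton/esym := qtrM x s.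
by rewrite -[RHS]mulg1 => /mulgI.
Qed.

Lemma qid_subproof S (x : qobj S) : qarrP x x (fun s => s) (fun=> 1%g).
Proof.
split=> [s|s|s0]; [exact: smooth_at_id|exact: act1|].
by apply: nearW => s; rewrite mul1g mulg1.
Qed.

Definition qid S (x : qobj S) : qarr x x (fun s => s) :=
  exist _ _ (qid_subproof x).

Lemma qcomp_subproof S T V (x : qobj S) (y : qobj T) (z : qobj V)
    (f : S -> T) (g : T -> V) (a : qarr x y f) (b : qarr y z g) :
  qarrP x z (fun s => g (f s)) (fun s => (sval b (f s) * sval a s)%g).
Proof.
case: a b => [e [sf fe ke]] [e' [sg ge' ke']] /=; split=> [|s|s0].
- exact: smooth_comp sf sg.
- by rewrite actM fe ge'.
- have := near_continuous (smooth_continuous sf (x := s0)) (ke' (f s0)).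
  apply: filterS2 (ke s0) => s kes ke's.
  by rewrite mulgA ke's -!mulgA kes.
Qed.

Definition qcomp S T V (x : qobj S) (y : qobj T) (z : qobj V)
    (f : S -> T) (g : T -> V) (a : qarr x y f) (b : qarr y z g) :
    qarr x z (fun s => g (f s)) :=
  exist _ _ (qcomp_subproof a b).

Lemma qpull_trM S T (f : S -> T) (sf : smooth f) (y : qobj T) s0 :
  \forall s1 \near s0, \forall s \near s1,
    qtr y (f s0) (f s) = (qtr y (f s0) (f s1) * qtr y (f s1) (f s))%g.
Proof.
have := near_continuous (smooth_continuous sf (x := s0)) (qtrM y (f s0)).
apply: filterS => s1.
exact: (near_continuous (smooth_continuous sf (x := s1))).
Qed.

Lemma qpull_smooth S T (f : S -> T) (sf : smooth f) (y : qobj T) s0 :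
  smooth_at (fun s => act (qtr y (f s0) (f s)) (qmap y (f s))) s0.
Proof. exact: (smooth_at_comp (sf s0) (qsmooth y (f s0))). Qed.

Definition qpull S T (f : S -> T) (sf : smooth f) (y : qobj T) : qobj S :=
  QObj (qpull_trM sf y) (qpull_smooth sf y).

Lemma qpull_arr_subproof S T (f : S -> T) (sf : smooth f) (y : qobj T) :
  qarrP (qpull sf y) y f (fun=> 1%g).
Proof. by split => // s0; apply: nearW => s; rewrite mul1g mulg1. Qed.

Definition qpull_arr S T (f : S -> T) (sf : smooth f) (y : qobj T) :
    qarr (qpull sf y) y f :=
  exist _ _ (qpull_arr_subproof sf y).

Lemma qarr_smooth S T (x : qobj S) (y : qobj T) (f : S -> T) :
  qarr x y f -> smooth f.
Proof. by case=> e []. Qed.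

Lemma qcomp1l S T (x : qobj S) (y : qobj T) (f : S -> T) (a : qarr x y f) :
  qcomp (qid x) a = a.
Proof. by apply: qarr_inj => s /=; rewrite mulg1. Qed.

Lemma qcomp1r S T (x : qobj S) (y : qobj T) (f : S -> T) (a : qarr x y f) :
  qcomp a (qid y) = a.
Proof. by apply: qarr_inj => s /=; rewrite mul1g. Qed.

Lemma qcompA S T V W (x : qobj S) (y : qobj T) (z : qobj V) (w : qobj W)
    (f : S -> T) (g : T -> V) (h : V -> W) (a : qarr x y f) (b : qarr y z g)
    (c : qarr z w h) :
  qcomp a (qcomp b c) = qcomp (qcomp a b) c.
Proof. by apply: qarr_inj => s /=; rewrite mulgA. Qed.

Lemma qlift S T (f : S -> T) : smooth f ->
  forall y : qobj T, exists x : qobj S, inhabited (qarr x y f).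
Proof.
by move=> sf y; exists (qpull sf y); split; exact: qpull_arr.
Qed.

Lemma qcartesian S T V (x : qobj S) (y : qobj T) (z : qobj V) (f : S -> T)
    (g : T -> V) (b : qarr y z g) (c : qarr x z (fun s => g (f s))) :
  smooth f -> exists! a : qarr x y f, qcomp a b = c.
Proof.
move=> sf; case: b c => [e [sg ge ke]] [e' [sgf gfe' ke']].
(* The only possible value, since a followed by b has to be c. *)
have aP : qarrP x y f (fun s => ((e (f s))^-1 * e' s)%g).
  split=> // [s|s0].
    by rewrite actM gfe' -ge -actM mulVg act1.
  have := near_continuous (smooth_continuous sf (x := s0)) (ke (f s0)).
  apply: filterS2 (ke' s0) => s ke's kes.
  by rewrite -mulgA -ke's !mulgA; congr (_ * _)%g; apply: (mulIg (e (f s)));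
    rewrite mulgKV -[RHS]mulgA kes mulKg.
exists (exist _ _ aP); split; first by apply: qarr_inj => s /=; rewrite mulKVg.
move=> [a' a'P] /(congr1 sval)/= E; apply: qarr_inj => s /=.
by have /(congr1 (fun u => u s)) /= <- := E; rewrite mulKg.
Qed.

Definition quotient_stack : fibered R :=
  @Fibered R qobj qarr qarr_smooth qid qcomp qcomp1l qcomp1r qcompA qlift
    qcartesian.

(** An arrow is a function on points, and each point s is in the sieve through the constant map from
    the one-point manifold; [u s] is the value of m there. Naturality shows that m is composition
    with u everywhere, and gives uniqueness. *)
Lemma quotient_glue_arrows : glue_arrows quotient_stack.
Proof.
move=> S C x y [oC CS] m mN.
have hs (s : S) : in_sieve C (fun _ : point_manifold R => s).
  split; first by move=> t; exact: smooth_at_cst.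
  by have [U CU Us] := CS s; exists U => // _ [_ _ <-].
pose xs (s : S) : qobj (point_manifold R) := qpull (hs s).1 x.
pose u (s : S) : gT := sval (m _ (xs s) _ (hs s) (qpull_arr (hs s).1 x)) (pt R).
have mE T (z : qobj T) f (hf : in_sieve C f) (a : qarr z x f) t :
    sval (m T z f hf a) t = (u (f t) * sval a t)%g.
  have sc : smooth (fun _ : point_manifold R => t) by move=> ?; exact: smooth_at_cst.
  have := mN T (point_manifold R) z (qpull sc z) f (fun=> t) hf (hs (f t)) a
    (qpull_arr sc z).
  move=> /(congr1 sval) /(congr1 (fun e => e (pt R))) /=; rewrite mulg1 => <-.
  (* The pullback of z to the point t and that of x to the point f t are identified by the value of
     [a] at t; naturality along this arrow expresses m through u. *)
  have bP : qarrP (qpull sc z) (xs (f t)) (fun s => s) (fun=> sval a t).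
    split=> [s|s|s0]; first exact: smooth_at_id.
      by case: a => e [] /=.
    by apply: (@filterE _ (nbhs s0)) => s /=; rewrite !qtr1 mul1g mulg1.
  have := mN (point_manifold R) (point_manifold R) (xs (f t)) (qpull sc z) _ (fun s => s)
    (hs (f t)) (hs (f t)) (qpull_arr (hs (f t)).1 x) (exist _ _ bP).
  move=> /(congr1 sval) /(congr1 (fun e => e (pt R))) /= E.
  rewrite -[RHS]E; congr (sval (m _ _ _ _ _) _).
  by apply: qarr_inj => s /=; rewrite mul1g mulg1.
have uP : qarrP x y (fun s => s) u.
  split=> [s|s|s0]; first exact: smooth_at_id.
    rewrite /u; case: (m _ _ _ _ _) => e [_ + _] /= => /(_ (pt R)).
    by [].
  (* Compatibility with the transitions is local, and a chart inside a member of the cover belongs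
     to the sieve, so m provides a genuine arrow over it. *)
  have [U CU Us0] := CS s0; have [c] := small_chartP (oC U CU) Us0.
  have sc := sc_smooth c.
  have hc : in_sieve C (@sc_map _ _ _ _ c).
    by split => //; exists U => //; exact: sc_range.
  have [_ _ +] := svalP (m _ (qpull sc x) _ hc (qpull_arr sc x)).
  move=> /(_ (sc_inv c s0)).
  have := sc_inv_smooth c (sc_inv c s0); have := sc_invK c (sc_inv c s0).
  rewrite sc_center => cK /smooth_at_continuous ci /(near_continuous ci).
  apply: filterS2 cK => s cs.
  by rewrite !mE /= cs !mulg1 sc_center.
exists (exist _ _ uP); split=> [T z f hf a|[u' u'P] H].
  by apply: qarr_inj => t /=; exact: mE.
apply: qarr_inj => s /=; rewrite /u.
by have /(congr1 (fun a => sval a (pt R))) /= -> := H _ _ _ (hs s)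
  (qpull_arr (hs s).1 x); rewrite mulg1.
Qed.

(** * Effectiveness of descent *)

Section GlueObjects.
Variables (S : manifold R) (C : set (set S)).
Hypothesis coverC : open_cover C.
Variable x : forall T (f : T -> S), in_sieve C f -> qobj T.
Variable r : forall T T' (f : T -> S) (g : T' -> T) (hf : in_sieve C f)
  (hfg : in_sieve C (fun t => f (g t))),
  smooth g -> qarr (x hfg) (x hf) g.
Hypothesis rM : forall T T' T'' (f : T -> S) (g : T' -> T) (g' : T'' -> T')
  (hf : in_sieve C f) (hfg : in_sieve C (fun t => f (g t)))
  (hfgg' : in_sieve C (fun t => f (g (g' t))))
  (hg : smooth g) (hg' : smooth g') (hgg' : smooth (fun t => g (g' t))),
  qcomp (@r T' T'' (fun t => f (g t)) g' hfg hfgg' hg') (r hf hfg hg) =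
    @r T T'' f (fun t => g (g' t)) hf hfgg' hgg'.

Lemma point_in_sieve (s : S) : in_sieve C (fun _ : point_manifold R => s).
Proof.
split; first by move=> t; exact: smooth_at_cst.
by have [U CU Us] := coverC.2 s; exists U => // _ [_ _ <-].
Qed.

Lemma point_smooth T (t : T) : smooth (fun _ : point_manifold R => t).
Proof. by move=> ?; exact: smooth_at_cst. Qed.

(* Comparison of the fibre of [x hf] at t with that of the point f t. *)
Definition descent_fib T (f : T -> S) (hf : in_sieve C f) (t : T) : gT :=
  sval (@r T _ f (fun=> t) hf (point_in_sieve (f t)) (point_smooth t)) (pt R).

(** The glued object takes as fibre at s the fibre of the datum over the point s. *)
Definition descent_map (s : S) : A := qmap (x (point_in_sieve s)) (pt R).

Lemma descent_fib_map T (f : T -> S) (hf : in_sieve C f) t :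
  act (descent_fib hf t) (descent_map (f t)) = qmap (x hf) t.
Proof.
by rewrite /descent_fib; case: (r _ _ _) => e [_ + _] /= => /(_ (pt R)).
Qed.

Lemma descent_fib_comp T T' (f : T -> S) (g : T' -> T) (hf : in_sieve C f)
    (hfg : in_sieve C (fun t => f (g t))) (hg : smooth g) t :
  (sval (r hf hfg hg) t * descent_fib hfg t)%g = descent_fib hf (g t).
Proof.
have := rM hf hfg (point_in_sieve (f (g t))) hg (point_smooth t)
  (point_smooth (g t)).
by move=> /(congr1 (fun a => sval a (pt R))).
Qed.

(** The transition of [x hf] read in the trivializations attached to the points f t0 and f t. In
    contrast with [qtr (x hf)], its germ depends only on the germ of f, by [descent_tr_local]. *)
Definition descent_tr T (f : T -> S) (hf : in_sieve C f) (t0 t : T) : gT :=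
  ((descent_fib hf t0)^-1 * qtr (x hf) t0 t * descent_fib hf t)%g.

Lemma descent_tr_ext T (f f' : T -> S) (hf : in_sieve C f)
    (hf' : in_sieve C f') : f = f' -> descent_tr hf = descent_tr hf'.
Proof. by move=> E; subst f'; congr descent_tr. Qed.

Lemma descent_tr_comp T T' (f : T -> S) (g : T' -> T) (hf : in_sieve C f)
    (hfg : in_sieve C (fun t => f (g t))) (hg : smooth g) t0 :
  \forall t \near t0, descent_tr hf (g t0) (g t) = descent_tr hfg t0 t.
Proof.
have [_ _ /(_ t0)] := svalP (r hf hfg hg); apply: filterS => t rt.
rewrite /descent_tr -!(descent_fib_comp hf hfg hg) invMg -!mulgA.
congr (_ * _)%g; rewrite (mulgA (qtr _ _ _)) rt -!mulgA mulKg //.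
Qed.

Lemma in_sieve_comp T T' (f : T -> S) (g : T' -> T) :
  in_sieve C f -> smooth g -> in_sieve C (fun t => f (g t)).
Proof.
move=> [sf [U CU fU]] sg; split; first exact: smooth_comp.
by exists U => // _ [t _ <-]; apply: fU; exists (g t).
Qed.

(** The map g is smooth and f0 o g equals f1 only near t1, so the descent datum does not apply to g
    directly. On a small chart around t1 both conditions hold everywhere, and the two transitions
    restrict to that of one and the same member of the sieve. *)
Lemma descent_tr_local T0 T1 (f0 : T0 -> S) (f1 : T1 -> S)
    (h0 : in_sieve C f0) (h1 : in_sieve C f1) (g : T1 -> T0) t1 :
  smooth_at g t1 -> (\forall t \near t1, f0 (g t) = f1 t) ->
  \forall t \near t1, descent_tr h0 (g t1) (g t) = descent_tr h1 t1 t.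
Proof.
move=> /smooth_at_nearby sg fg.
have : \forall t \near t1, smooth_at g t /\ f0 (g t) = f1 t by exact: filterI.
rewrite {1}/prop_near1 nbhsE => -[U [oU Ut1] UP].
have [c] := small_chartP oU Ut1.
pose j := @sc_map _ _ _ _ c.
have jU t : U (j t) by apply: (sc_range c); exists t.
have sgj : smooth (fun t => g (j t)).
  by move=> t; apply: (smooth_at_comp (sc_smooth c t)); have [] := UP _ (jU t).
have hj := in_sieve_comp h1 (sc_smooth c).
have hgj := in_sieve_comp h0 sgj.
have E : (fun t => f0 (g (j t))) = (fun t => f1 (j t)).
  by apply/funext => t; have [] := UP _ (jU t).
have := descent_tr_comp h1 hj (sc_smooth c) (sc_inv c t1).
have := descent_tr_comp h0 hgj sgj (sc_inv c t1).
rewrite (descent_tr_ext hgj hj E) -/j => H0 H1.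
have H : \forall t \near sc_inv c t1, descent_tr h0 (g (j (sc_inv c t1)))
    (g (j t)) = descent_tr h1 (j (sc_inv c t1)) (j t).
  by apply: filterS2 H0 H1 => t -> ->.
have := sc_inv_smooth c (sc_inv c t1); have := sc_invK c (sc_inv c t1).
rewrite sc_center => cK /smooth_at_continuous ci.
move: H => /(near_continuous ci).
by apply: filterS2 cK => t ct; rewrite /j ct sc_center.
Qed.

Record sieve_chart (s : S) := SieveChart {
  sch_open : set S;
  sch_cover : C sch_open;
  sch_chart :> small_chart sch_open s }.

Lemma sieve_chartP s : inhabited (sieve_chart s).
Proof.
have [U CU Us] := coverC.2 s; have [c] := small_chartP (coverC.1 U CU) Us.
by split; exact: SieveChart CU c.
Qed.

Definition sch s : sieve_chart s := inhabited_witness (sieve_chartP s).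

Lemma sch_sieve s : in_sieve C (@sc_map _ _ _ _ (sch s)).
Proof.
split; first exact: sc_smooth.
by exists (sch_open (sch s)); [exact: sch_cover|exact: sc_range].
Qed.

Definition descent_qtr (s0 s : S) : gT :=
  descent_tr (sch_sieve s0) (sc_inv (sch s0) s0) (sc_inv (sch s0) s).

(** Every member of the sieve passing through a point computes the same germ of transitions there,
    so the chart chosen by [sch] leaves no trace. *)
Lemma descent_qtrE T (f : T -> S) (hf : in_sieve C f) t :
  \forall t' \near t, descent_qtr (f t) (f t') = descent_tr hf t t'.
Proof.
have := sc_inv_smooth (sch (f t)) (sc_inv (sch (f t)) (f t)).
have := sc_invK (sch (f t)) (sc_inv (sch (f t)) (f t)).
rewrite sc_center => cK cS.
exact: (descent_tr_local (sch_sieve (f t)) hf (smooth_at_comp (hf.1 t) cS)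
  (near_continuous (smooth_continuous hf.1 (x := t)) cK)).
Qed.

(** The transitions from s0 and from s1 are computed in two different charts; [descent_qtrE] moves
    the second into the chart at s0, where the identity is that of one object of the datum. *)
Lemma descent_qtrM s0 : \forall s1 \near s0, \forall s \near s1,
  descent_qtr s0 s = (descent_qtr s0 s1 * descent_qtr s1 s)%g.
Proof.
set c := sch s0.
have := sc_inv_smooth c (sc_inv c s0); have := sc_invK c (sc_inv c s0).
rewrite sc_center => cK cS; have cc := smooth_at_continuous cS.
have qM := near_continuous cc (qtrM (x (sch_sieve s0)) (sc_inv c s0)).
apply: filterS3 (near_join cK) (smooth_at_nearby cS) qM => s1 cKs1 cSs1.
have cs1 := nbhs_singleton cKs1.
have cc1 := smooth_at_continuous cSs1.
move=> /(near_continuous cc1) qM1.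
have := near_continuous cc1 (descent_qtrE (sch_sieve s0) (sc_inv c s1)).
rewrite -/c cs1 => qE1.
apply: filterS3 cKs1 qE1 qM1 => s cs; rewrite cs => Es Ms.
rewrite Es /descent_qtr -/c /descent_tr Ms !mulgA; congr (_ * _ * _)%g.
by rewrite mulgK.
Qed.

Lemma descent_smooth s0 :
  smooth_at (fun s => act (descent_qtr s0 s) (descent_map s)) s0.
Proof.
set c := sch s0; pose t0 := sc_inv c s0.
have := sc_inv_smooth c t0; have := sc_invK c t0.
rewrite sc_center => cK cS.
have := smooth_at_comp cS (qsmooth (x (sch_sieve s0)) t0).
(* Passing from the trivialization of [x] at t0 to that of the point s0 is the action of one fixed
   element of the group. *)
move=> /smooth_at_comp /(_ (act_smooth (descent_fib (sch_sieve s0) t0)^-1%g _)).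
apply: smooth_at_near; apply: filterS cK => s cs.
have <- := descent_fib_map (sch_sieve s0) (sc_inv c s).
by rewrite -/c cs -!actM.
Qed.

Definition descent_obj : qobj S := QObj descent_qtrM descent_smooth.

Lemma descent_arr_subproof T (f : T -> S) (hf : in_sieve C f) :
  qarrP (x hf) descent_obj f (fun t => (descent_fib hf t)^-1%g).
Proof.
split=> [|t|t0]; first exact: hf.1.
  by rewrite -descent_fib_map -actM mulVg act1.
by apply: filterS (descent_qtrE hf t0) => t /= ->; rewrite /descent_tr mulgK.
Qed.

Definition descent_arr T (f : T -> S) (hf : in_sieve C f) :
  qarr (x hf) descent_obj f := exist _ _ (descent_arr_subproof hf).

Lemma descent_arrM T T' (f : T -> S) (g : T' -> T) (hf : in_sieve C f)
    (hfg : in_sieve C (fun t => f (g t))) (hg : smooth g) :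
  qcomp (r hf hfg hg) (descent_arr hf) = descent_arr hfg.
Proof.
by apply: qarr_inj => t /=; rewrite -(descent_fib_comp hf hfg hg) invMg mulgKV.
Qed.

End GlueObjects.

Lemma quotient_glue_objects : glue_objects quotient_stack.
Proof.
move=> S C coverC x r _ rM.
pose r' T T' f g hf hfg hg := r T T' f g hf hfg hg : qarr (x T' _ hfg) (x T f hf) g.
exists (@descent_obj S C coverC x r' rM), (@descent_arr S C coverC x r' rM).
exact: descent_arrM.
Qed.

End QuotientStack.

(** * Torsors as manifolds and the orbifold structure *)

(* The total space of the torsor described by x; the topology is the one for
   which the sections [sheet p] are local homeomorphisms. *)
Definition total (R : realType) (A : manifold R) (gT : finGroupType)
  (act : gT -> A -> A) (T : manifold R) (x : qobj act T) : Type := (T * gT)%type.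

Section TotalSpace.
Variables (R : realType) (A : manifold R) (gT : finGroupType).
Variables (act : gT -> A -> A) (T : manifold R) (x : qobj act T).
Local Notation P := (total x).

(** The local section of the torsor through p, continued by the transition elements from its base
    point. *)
Definition sheet (p : P) (t : T) : P := (t, (p.2 * qtr x p.1 t)%g).

Definition total_nbhs (p : P) : set_system P := sheet p @ nbhs p.1.

Lemma sheet_self (p : P) : sheet p p.1 = p.
Proof. by case: p => t g; rewrite /sheet qtr1 mulg1. Qed.

(** Where the cocycle identity based at t0 holds, the section through p agrees near t with the
    section through its own value at t; the interior is taken to get an open domain. *)
Definition sheet_dom (t0 : T) : set T :=
  ([set t | \forall t' \near t, qtr x t0 t' = (qtr x t0 t * qtr x t t')%g])°.

Lemma sheet_dom_open t0 : open (sheet_dom t0).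
Proof. exact: open_interior. Qed.

Lemma sheet_dom_self t0 : sheet_dom t0 t0.
Proof. exact: qtrM. Qed.

Lemma sheet_domP (p : P) t : sheet_dom p.1 t ->
  \forall t' \near t, sheet (sheet p t) t' = sheet p t'.
Proof.
move=> /interior_subset; apply: filterS => t' E.
by rewrite /sheet /= E mulgA.
Qed.

Lemma sheet_dom_nbhs (p : P) : \forall t \near p.1, sheet_dom p.1 t.
Proof. exact: (open_nbhs_nbhs (conj (sheet_dom_open _) (sheet_dom_self _))). Qed.

HB.instance Definition _ := Choice.copy P (T * gT)%type.

HB.instance Definition _ := hasNbhs.Build P total_nbhs.

Lemma total_nbhs_filter (p : P) : ProperFilter (nbhs p).
Proof. exact: fmap_proper_filter. Qed.

Lemma total_nbhs_singleton (p : P) (B : set P) : nbhs p B -> B p.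
Proof. by move=> /nbhs_singleton pB; rewrite -(sheet_self p). Qed.

Lemma total_nbhs_nbhs (p : P) (B : set P) : nbhs p B -> nbhs p (nbhs^~ B).
Proof.
move=> /near_join BB.
rewrite /nbhs /= /total_nbhs nbhs_simpl /=.
apply: filterS2 BB (sheet_dom_nbhs p) => t Bt /sheet_domP Et.
apply: filterS2 Bt Et => t' Bt' Et'.
by change (B (sheet (sheet p t) t')); rewrite Et'.
Qed.

HB.instance Definition _ := Nbhs_isNbhsTopological.Build P
  total_nbhs_filter total_nbhs_singleton total_nbhs_nbhs.

Definition total_proj (p : P) : T := p.1.

Lemma total_proj_continuous : continuous total_proj.
Proof. by move=> p B. Qed.

Lemma sheet_continuous (p : P) t : sheet_dom p.1 t -> {for t, continuous (sheet p)}.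
Proof.
by move=> /sheet_domP Et B Bt; apply: filterS2 Et Bt => t' /= ->.
Qed.

Lemma sheet_open (p : P) (U : set T) : open U -> U `<=` sheet_dom p.1 ->
  open (sheet p @` U).
Proof.
rewrite !openE => oU UO _ [t Ut <-].
rewrite /interior /nbhs /= /total_nbhs nbhs_simpl /=.
apply: filterS2 (oU t Ut) (sheet_domP (UO t Ut)) => t' Ut' E.
by exists t'.
Qed.

(** Points over distinct base points are separated in T. Over the same base point, two sheets are
    right translates by the same transition elements, so they coincide as soon as they meet. *)
Lemma total_hausdorff : hausdorff_space P.
Proof.
move=> p q pq.
have E : p.1 = q.1.
  apply: (@mhausdorff _ T) => U V pU qV.
  have [z [Uz Vz]] := pq (total_proj @^-1` U) (total_proj @^-1` V)
    (total_proj_continuous pU) (total_proj_continuous qV).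
  by exists z.1.
have [_ [[t _ <-] [t' _ [tt']]]] : range (sheet p) `&` range (sheet q) !=set0.
  have pS (p' : P) : nbhs p' (range (sheet p')).
    by apply: (@filterE T (nbhs p'.1)) => t /=; exists t.
  exact: pq.
rewrite tt' E => /mulIg; case: p q E {pq tt'} => [p1 p2] [q1 q2] /= -> ->//.
Qed.

Lemma total_second_countable : @second_countable P.
Proof.
have [B cB [oB bB]] := @msecond_countable _ T.
(* A basic open set U1 contained in some sheet_dom selects a section over it;
   its restrictions to the basic open sets U2 form a countable basis. *)
pose good U t0 := U `<=` sheet_dom t0.
pose F (i : set T * set T * gT) : set P :=
  if pselect (exists t0, good i.1.1 t0) is left H
  then sheet (sval (cid H), i.2) @` (i.1.1 `&` i.1.2) else set0.
exists (F @` (B `*` B `*` setT)).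
  apply: (sub_countable (card_image_le F _)).
  by apply: countableX; [exact: countableX|exact: countableP].
split.
  move=> _ [[[U1 U2] g] [[/= BU1 BU2] _] <-]; rewrite /F /=.
  case: pselect => [H|_]; last exact: open0.
  case: (cid H) => t0 /= gt0.
  apply: sheet_open; last by move=> t [+ _]; exact: gt0.
  by apply: openI; exact: oB.
move=> p N pN.
have [U1 [BU1 U1p] U1N] := bB _ _ (sheet_dom_nbhs p).
have H : exists t0, good U1 t0 by exists p.1.
pose t0 := sval (cid H); have gt0 : good U1 t0 := svalP (cid H).
(* The point over t0 whose sheet passes through p. *)
pose q : P := (t0, (p.2 * (qtr x t0 p.1)^-1)%g).
have qp : sheet q p.1 = p by rewrite /q /sheet /= mulgKV; case: (p).
have /(sheet_domP (p := q)) Eq := gt0 _ U1p.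
rewrite qp in Eq.
have [U2 [BU2 U2p] U2N] : exists2 U, B U /\ U p.1 & U `<=` [set t | N (sheet q t)].
  by apply: bB; apply: filterS2 Eq pN => t /= ->.
exists (F ((U1, U2), q.2)).
  split; first by exists ((U1, U2), q.2).
  rewrite /F /=; case: pselect => // H'; rewrite (Prop_irrelevance H' H).
  by exists p.1.
rewrite /F /=; case: pselect => // H'; rewrite (Prop_irrelevance H' H).
by move=> _ [t [_ /U2N Nt] <-].
Qed.

(** All charts that are a chart of T after projection; their changes of coordinates are those of
    T. *)
Definition total_atlas : set (chart R P (mdim T)) :=
  [set e : chart R P (mdim T) | exists2 c, matlas c &
    forall p : P, cdom e p -> cdom c p.1 /\ e p = c p.1].

Lemma total_atlasP (e : chart R P (mdim T)) (c : chart R T (mdim T)) y :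
  (forall p : P, cdom e p -> cdom c p.1 /\ e p = c p.1) -> ccod e y ->
  ccod c y /\ (cinv e y).1 = cinv c y.
Proof.
move=> ec ey; have [cp ep] := ec _ (cinv_dom ey).
rewrite cinvK // in ep; split; first by rewrite [y]ep; exact: cto_cod.
by rewrite [in RHS]ep ctoK.
Qed.

Lemma total_atlas_cover (p : P) : exists2 e, total_atlas e & cdom e p.
Proof.
have [c cT cp] := matlas_cover p.1.
pose O := sheet_dom p.1 `&` cdom c.
have oO : open O by apply: openI; [exact: sheet_dom_open|exact: cdom_open].
pose D := [set q : P | O q.1 /\ sheet p q.1 = q].
have oD : open D.
  have -> : D = sheet p @` O.
    apply/seteqP; split => q; first by move=> [Oq <-]; exists q.1.
    by move=> [t Ot <-].
  by apply: sheet_open => // t [].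
pose V := [set y | ccod c y /\ O (cinv c y)].
have oV : open V := @chart_capP _ _ _ c _ oO.
have D1 (q : P) : D q -> V (c q.1).
  by move=> [[Oq cq] _]; split; [exact: cto_cod|rewrite /= ctoK].
have D2 y : V y -> D (sheet p (cinv c y)) by move=> [].
have D3 (q : P) : D q -> sheet p (cinv c (c q.1)) = q.
  by move=> [[_ cq] qE]; rewrite ctoK.
have D4 y : V y -> c (sheet p (cinv c y)).1 = y by move=> [cy _] /=; rewrite cinvK.
have D5 (q : P) : D q -> {for q, continuous (fun q : P => c q.1)}.
  move=> [[_ cq] _]; apply: (@continuous_comp _ _ _ total_proj c).
    exact: total_proj_continuous.
  exact: cto_continuous.
have D6 y : V y -> {for y, continuous (fun y => sheet p (cinv c y))}.
  move=> [cy [Oy _]]; apply: (@continuous_comp _ _ _ (cinv c) (sheet p)).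
    exact: cinv_continuous.
  exact: sheet_continuous.
exists (@Chart R P (mdim T) D V (fun q => c q.1) (fun y => sheet p (cinv c y))
  oD oV D1 D2 D3 D4 D5 D6).
  by exists c => // q [[]].
by split; [split => //; exact: sheet_dom_self|exact: sheet_self].
Qed.

Lemma total_atlas_compat (e e' : chart R P (mdim T)) :
  total_atlas e -> total_atlas e' ->
  Cinf [set y | ccod e y /\ cdom e' (cinv e y)] (e' \o cinv e).
Proof.
move=> [c cT ec] [c' c'T ec'].
have oD : open [set y | ccod e y /\ cdom e' (cinv e y)].
  by apply: chart_capP; exact: cdom_open.
apply: (@Cinf_ext _ _ _ _ (c' \o cinv c)) => //.
  move=> y [ey /ec'[_ /= ->]].
  by have [_ ->] := total_atlasP ec ey.
apply: Cinf_sub (matlas_compat cT c'T) => y [ey /ec'[+ _]].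
by have [cy ->] := total_atlasP ec ey.
Qed.

Definition total_manifold : manifold R := Manifold total_hausdorff
  total_second_countable total_atlas_cover total_atlas_compat.

Lemma total_proj_smooth : smooth (total_proj : total_manifold -> T).
Proof.
move=> p; have [e [c cT ec] ep] := @matlas_cover _ total_manifold p.
have [cp _] := ec p ep.
exists e, c, (ccod e); split => //.
- by split => //; exists c.
- by split; [exact: ccod_open|exact: cto_cod].
- by move=> y ey; split => //; have [] := ec _ (cinv_dom ey).
- have oe := @ccod_open _ _ _ e.
  apply: (@Cinf_ext _ _ _ _ id) => //; last exact: Cinf_id.
  move=> y ey /=; have [_ <-] := ec _ (cinv_dom ey).
  by rewrite cinvK.
Qed.

Lemma sheet_smooth_self (p : total_manifold) :
  smooth_at (sheet p : T -> total_manifold) p.1.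
Proof.
have [e eP ep] := @matlas_cover _ total_manifold p.
have [c cT ec] := eP; have [cp _] := ec p ep.
pose U := [set t | sheet_dom p.1 t /\ cdom e (sheet p t)].
have oU : open U.
  apply: (@open_capP _ _ _ _ (sheet p) (sheet_dom_open p.1)) => [t|].
    exact: sheet_continuous.
  exact: cdom_open.
pose W := [set y | ccod c y /\ U (cinv c y)].
have oW : open W := @chart_capP _ _ _ c _ oU.
exists c, e, W; split => //.
- by rewrite sheet_self.
- split => //; split; first exact: cto_cod.
  by rewrite /= ctoK //; split; [exact: sheet_dom_self|rewrite sheet_self].
- by move=> y [cy [_ ey]].
- apply: (@Cinf_ext _ _ _ _ id) => //; last exact: Cinf_id.
  by move=> y [cy [_ /ec[_ /= ->]]] /=; rewrite cinvK.
Qed.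

Lemma sheet_smooth (p : total_manifold) t : sheet_dom p.1 t ->
  smooth_at (sheet p : T -> total_manifold) t.
Proof.
move=> /sheet_domP Et.
exact: (@smooth_at_near _ T total_manifold _ _ t Et
  (sheet_smooth_self (sheet p t))).
Qed.

Lemma total_proj_etale : etale (total_proj : total_manifold -> T).
Proof.
split=> [|p]; first exact: total_proj_smooth.
have oS : open (sheet p @` sheet_dom p.1).
  by apply: sheet_open => //; exact: sheet_dom_open.
have E : total_proj @` (sheet p @` sheet_dom p.1) = sheet_dom p.1.
  apply/seteqP; split => [_ [_ [t ? <-] <-] //|t Ot].
  by exists (sheet p t) => //; exists t.
exists (sheet p @` sheet_dom p.1), (sheet p); split.
- by split => //; exists p.1; [exact: sheet_dom_self|exact: sheet_self].
- by rewrite E; exact: sheet_dom_open.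
- by move=> _ [t _ <-].
- by rewrite E => t; exact: sheet_smooth.
Qed.

(** Near s the map is its projection to T followed by the sheet through h s. *)
Lemma total_smooth_at (S : manifold R) (h : S -> total_manifold) s :
  smooth_at (fun s => (h s).1) s ->
  (\forall s' \near s, h s' = sheet (h s) (h s').1) -> smooth_at h s.
Proof.
move=> h1 hE.
have H := smooth_at_comp h1 (sheet_smooth_self (h s)).
have hE' : \forall s' \near s, sheet (h s) (h s').1 = h s'.
  by apply: filterS hE => s' ->.
exact: (@smooth_at_near _ S total_manifold _ _ s hE' H).
Qed.

End TotalSpace.

Arguments total_proj_smooth {R A gT act T} x _.

(** * Atlas, isotropy and underlying space of the quotient stack *)

Section QuotientOrbifold.
Variables (R : realType) (A : manifold R) (gT : finGroupType).
Variable act : gT -> A -> A.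
Hypothesis act1 : forall x, act 1%g x = x.
Hypothesis actM : forall g h x, act (g * h)%g x = act g (act h x).
Hypothesis act_smooth : forall g, smooth (act g).

Local Notation X := (quotient_stack act1 actM).

Lemma qarr_existT S T (z : qobj act S) (x : qobj act T) (k k' : S -> T)
    (a : qarr z x k) (a' : qarr z x k') :
  existT (fun k => qarr z x k) k a = existT _ k' a' <->
  k =1 k' /\ sval a =1 sval a'.
Proof.
split=> [E|[/funext kk' aa']].
  split=> s; first exact: (congr1 (fun u => projT1 u s) E).
  exact: (congr1 (fun u => sval (projT2 u) s) E).
by subst k'; congr existT; exact: qarr_inj.
Qed.

Lemma triv_trM (s0 : A) : \forall s1 \near s0, \forall s \near s1,
  (1 = 1 * 1 :> gT)%g.
Proof. by apply: nearW => s1; apply: nearW => s; rewrite mulg1. Qed.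

Lemma triv_smooth (s0 : A) : smooth_at (fun s => act 1%g s) s0.
Proof. exact: act_smooth. Qed.

Definition triv_obj : qobj act A := QObj triv_trM triv_smooth.

Lemma total_near_sheet T (x : qobj act T) (p : total x) :
  \forall p' \near p, p' = sheet p p'.1.
Proof. exact: (@filterE T (nbhs p.1)). Qed.

(** The fibre product of T and A over the quotient is the total space of the torsor x, with the
    equivariant map [q'] to A. Arrows e to x and e' to the trivial object single out the point of
    the torsor with group component e' e^-1, which is the factorization. *)
Lemma quotient_etale_atlas : @etale_atlas R X A triv_obj.
Proof.
move=> T x.
pose q' (p : total_manifold x) : A := act p.2 (qmap x p.1).
pose w := qpull (total_proj_smooth x) x.
have b'P : qarrP w triv_obj q' (fun p : total_manifold x => p.2).
  split=> // [p|p].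
    have H := smooth_at_comp (smooth_at_comp (total_proj_smooth x p)
      (qsmooth x p.1)) (act_smooth p.2 _).
    have E : \forall p' \near (p : total_manifold x),
        act p.2 (act (qtr x p.1 (total_proj p')) (qmap x (total_proj p'))) = q' p'.
      apply: filterS (total_near_sheet p) => p' E.
      by rewrite -actM /q' [in RHS]E.
    exact: (@smooth_at_near _ (total_manifold x) A _ _ p E H).
  by apply: filterS (total_near_sheet p) => p' E; rewrite mul1g [in LHS]E.
exists (total_manifold x), (@total_proj _ _ _ _ _ x), q', w.
exists (qpull_arr act1 (total_proj_smooth x) x), (exist _ _ b'P).
split=> [|t|S z f f' [e [sf fe ke]] [e' [sf' fe' ke']]].
- exact: total_proj_etale.
- by exists (t, 1%g).
pose h (s : S) : total_manifold x := (f s, (e' s * (e s)^-1)%g).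
have uP : qarrP z w h e.
  split=> // s0; apply: total_smooth_at => //.
  apply: filterS2 (ke s0) (ke' s0) => s Es E's.
  rewrite /h /sheet /=; congr pair.
  move: E's; rewrite mul1g => ->; rewrite -!mulgA; congr (_ * _)%g.
  by apply: (mulIg (e s)); rewrite mulgKV -mulgA Es mulKg.
exists (existT _ h (exist _ _ uP)); split.
  split; apply/qarr_existT; split=> s //=; rewrite ?mul1g ?mulgKV //.
  by rewrite /q' /h /= -fe -actM mulgKV fe'.
move=> [h' [e'' e''P]] /= [/qarr_existT /= [h1 e1] /qarr_existT /= [h2 e2]].
have ee s : e'' s = e s by rewrite -e1 mul1g.
apply/(@qarr_existT S (total_manifold x) z w); split=> s //=.
rewrite /h -h1 -e2 ee mulgK.
by case: (h' s).
Qed.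

(** Over a one-point manifold an automorphism is a single element of the finite group. *)
Lemma quotient_isotropy : finite_isotropy X.
Proof.
move=> T x [t tE].
pose F (a : qarr x x (fun t => t)) : gT := sval a t.
have Finj : {in [set: qarr x x (fun t => t)] &, injective F}.
  by move=> a b _ _ ab; apply: qarr_inj => s; rewrite (tE s).
rewrite -(eq_finite_set (inj_card_eq Finj)); exact: finite_finset.
Qed.

Definition quotient_orbifold : orbifold R (mdim A) :=
  @Orbifold R _ X (conj (@quotient_glue_arrows _ _ _ _ _ _)
    (quotient_glue_objects act_smooth)) A erefl triv_obj
    quotient_etale_atlas quotient_isotropy.

Variables (M : topologicalType) (pr : A -> M).
Hypothesis pr_surj : forall c, exists a, pr a = c.
Hypothesis pr_orbit : forall a b, pr a = pr b <-> exists g, act g a = b.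
Hypothesis pr_open : forall U, open U <-> open (pr @^-1` U).

Lemma quotient_underlying_space :
  @underlying_space R X M (fun T x t => pr (qmap x t)).
Proof.
split.
- move=> S T x y f [e [_ fe _]] s; apply/pr_orbit; exists (e s); exact: fe.
- move=> T x y t [t' tE] /pr_orbit[g gxy].
  split; exists (fun=> g); split=> [s|s|s]; first exact: smooth_at_id.
    by rewrite (tE s) -(tE t).
  by apply: filterE => s'; rewrite (tE s) (tE s') !qtr1 mul1g mulg1.
- move=> c; have [a <-] := pr_surj c.
  exists (point_manifold R),
    (qpull (f := fun=> a) (fun _ => smooth_at_cst _ _) triv_obj), (pt R).
  by split => //; exact: is_point_manifold.
- move=> U; split=> [/pr_open oU T x|H].
    rewrite openE => t /= Ut; rewrite /interior.
    have := smooth_at_continuous (qsmooth x t).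
    (* [qmap x] may be discontinuous, but it differs from a map smooth at t by elements of the
       group, which [pr] does not see. *)
    have Ex s : pr (act (qtr x t s) (qmap x s)) = pr (qmap x s).
      by apply/esym/pr_orbit; exists (qtr x t s).
    move=> /near_continuous /(_ (open_nbhs_nbhs (conj oU _))).
    rewrite /= Ex => /(_ Ut).
    by apply: filterS => s; rewrite /= Ex.
  by apply/pr_open; exact: (H A triv_obj).
Qed.

Theorem quotient_orbifold_structure : orbifold_structure R M (mdim A).
Proof.
exact: (OrbifoldStructure (sorb := quotient_orbifold)
  quotient_underlying_space).
Qed.

End QuotientOrbifold.

(** * Simplicial cones *)

Section Cones.
Variables (R : realType) (d : nat).

(** Coefficients are kept in R^n with a support condition, so that subfamilies can be compared
    without reindexing. *)
Definition indep n (v : 'M[R]_(n, d)) (I : {set 'I_n}) : Prop :=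
  forall c : 'rV[R]_n, (forall i, i \notin I -> c 0 i = 0) -> c *m v = 0 ->
  c = 0.

(** For injective f, extension of c by zero along f. *)
Definition push k n (f : 'I_k -> 'I_n) (c : 'rV[R]_k) : 'rV[R]_n :=
  c *m rowsub f 1%:M.

Lemma pushM k n (f : 'I_k -> 'I_n) c (v : 'M[R]_(n, d)) :
  push f c *m v = c *m rowsub f v.
Proof. by rewrite /push -mulmxA -rowsubE. Qed.

Lemma pushE k n (f : 'I_k -> 'I_n) c i : injective f ->
  push f c 0 (f i) = c 0 i.
Proof.
move=> finj; rewrite !mxE (bigD1 i) //= !mxE eqxx mulr1 big1 ?addr0 // => j ji.
by rewrite !mxE (inj_eq finj) (negbTE ji) mulr0.
Qed.

Lemma push_out k n (f : 'I_k -> 'I_n) (I : {set 'I_k}) (c : 'rV[R]_k) j :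
  (forall i, i \notin I -> c 0 i = 0) -> j \notin f @: I -> push f c 0 j = 0.
Proof.
move=> cI jI; rewrite !mxE big1 // => i _; rewrite !mxE.
case: eqP => [fij|_]; last by rewrite mulr0.
rewrite cI ?mul0r //; apply: contra jI => iI.
by rewrite -fij imset_f.
Qed.

Lemma push_ge0 k n (f : 'I_k -> 'I_n) (c : 'rV[R]_k) : (forall i, 0 <= c 0 i) ->
  forall j, 0 <= push f c 0 j.
Proof.
by move=> c0 j; rewrite mxE sumr_ge0 // => i _; rewrite !mxE mulr_ge0 // ler0n.
Qed.

Lemma push_colsub k n (f : 'I_k -> 'I_n) (I : {set 'I_k}) (c : 'rV[R]_n) :
  injective f -> (forall j, j \notin f @: I -> c 0 j = 0) ->
  push f (colsub f c) = c.
Proof.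
move=> finj cI; apply/rowP => j.
have [/imsetP[i iI ->]|jI] := boolP (j \in f @: [set: 'I_k]%SET).
  by rewrite pushE // mxE.
rewrite (@push_out _ _ f [set: 'I_k]%SET) //; last by move=> i; rewrite inE.
by rewrite cI //; apply: contra jI => /imsetP[i _ ->]; rewrite imset_f.
Qed.

Lemma cone_on_rowsub k n (f : 'I_k -> 'I_n) (v : 'M[R]_(n, d)) I :
  injective f -> cone_on (rowsub f v) I = cone_on v (f @: I).
Proof.
move=> finj; apply/seteqP; split=> _ [c [c0 cI] <-].
  exists (push f c); last by rewrite pushM.
  by split=> [|j]; [exact: push_ge0|exact: push_out].
exists (colsub f c); last by rewrite -pushM (push_colsub finj cI).
split=> i; rewrite mxE // => iI; apply: cI; rewrite mem_imset //.
Qed.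

Lemma indep_rowsub k n (f : 'I_k -> 'I_n) (v : 'M[R]_(n, d)) I :
  injective f -> indep (rowsub f v) I <-> indep v (f @: I).
Proof.
move=> finj; split=> H c cI.
  rewrite -(push_colsub finj cI) pushM => /H -> //; first by rewrite /push mul0mx.
  by move=> i iI; rewrite mxE cI // mem_imset.
rewrite -pushM => /H c0; apply/rowP => i; rewrite -(pushE c i finj) c0 ?mxE//.
by move=> j; exact: push_out.
Qed.

Lemma enum_val_setT n (I : {set 'I_n}) :
  (enum_val : 'I_#|I| -> 'I_n) @: [set: 'I_#|I|]%SET = I.
Proof.
apply/setP => i; apply/imsetP/idP => [[k _ ->]|iI]; first exact: enum_valP.
by exists (enum_rank_in iI i); rewrite ?enum_rankK_in.
Qed.

Lemma indep_setT k (w : 'M[R]_(k, d)) : indep w [set: 'I_k]%SET <-> row_free w.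
Proof.
split=> [H|wf c _ cw]; first by apply: inj_row_free => c /H -> // i; rewrite inE.
by apply: (row_free_inj wf); rewrite cw mul0mx.
Qed.

Definition rows_in n (v : 'M[R]_(n, d)) (I : {set 'I_n}) : 'M[R]_(#|I|, d) :=
  rowsub (enum_val : 'I_#|I| -> 'I_n) v.

Lemma rows_in_free n (v : 'M[R]_(n, d)) I : indep v I -> row_free (rows_in v I).
Proof.
move=> vI; apply/indep_setT/indep_rowsub; first exact: enum_val_inj.
by rewrite enum_val_setT.
Qed.

Lemma cone_of_rows_in n (v : 'M[R]_(n, d)) I :
  cone_of (rows_in v I) = cone_on v I.
Proof.
by rewrite /cone_of cone_on_rowsub ?enum_val_setT //; exact: enum_val_inj.
Qed.

Lemma indep_dual n (v : 'M[R]_(n, d)) I (a : 'I_n -> R) : indep v I ->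
  exists u : 'cV[R]_d, forall i, i \in I -> (row i v *m u) 0 0 = a i.
Proof.
move=> /rows_in_free/row_freeP[B vB].
exists (B *m \col_k a (enum_val k)) => i iI.
have -> : row i v = row (enum_rank_in iI i) (rows_in v I).
  by apply/rowP => j; rewrite !mxE enum_rankK_in.
by rewrite mulmxA -row_mul vB row1 -rowE !mxE enum_rankK_in.
Qed.

Lemma cone_on_row n (v : 'M[R]_(n, d)) (I : {set 'I_n}) i :
  i \in I -> cone_on v I (row i v).
Proof.
move=> iI; exists (delta_mx 0 i); last by rewrite -rowE.
split=> j; rewrite mxE ?ler0n // => jI.
by rewrite eqxx /=; case: eqP => // ji; rewrite -ji (negbTE jI) in iI.
Qed.

Lemma cone_on_subset n (v : 'M[R]_(n, d)) (I J : {set 'I_n}) :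
  J \subset I -> cone_on v J `<=` cone_on v I.
Proof.
move=> /fintype.subsetP JI _ [c [c0 cJ] <-]; exists c => //; split=> // i iI.
by apply: cJ; apply: contra iI; exact: JI.
Qed.

Lemma coneM_sum n (v : 'M[R]_(n, d)) (c : 'rV[R]_n) (u : 'cV[R]_d) :
  (c *m v *m u) 0 0 = \sum_i c 0 i * (row i v *m u) 0 0.
Proof.
rewrite -mulmxA mxE; apply: eq_bigr => i _; congr (_ * _).
by rewrite -row_mul [RHS]mxE.
Qed.

(** The face consists of the combinations of the generators killed by u: a sum of nonnegative terms
    vanishes only if each term does. *)
Lemma face_cone_on n (v : 'M[R]_(n, d)) (I : {set 'I_n}) t :
  face t (cone_on v I) -> exists2 J : {set 'I_n}, J \subset I & t = cone_on v J.
Proof.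
move=> [u [su ->]].
pose J := [set i in I | (row i v *m u) 0 0 == 0].
have JI : J \subset I by apply/fintype.subsetP => i; rewrite inE => /andP[].
exists J => //; apply/seteqP; split=> x.
  move=> [[c [c0 cI] <-]]; rewrite coneM_sum => s0.
  exists c => //; split=> // i iJ.
  have [iI|/cI//] := boolP (i \in I).
  have /psumr_eq0P/(_ s0 i isT)/eqP : forall i, xpredT i ->
      0 <= c 0 i * (row i v *m u) 0 0.
    move=> j _; have [jI|/cI->] := boolP (j \in I); last by rewrite mul0r.
    by rewrite mulr_ge0 // su //; exact: cone_on_row.
  by rewrite mulf_eq0 => /orP[/eqP//|viu]; rewrite inE iI viu in iJ.
move=> xJ; split; first exact: cone_on_subset xJ.
move: xJ => [c [c0 cJ] <-]; rewrite coneM_sum big1 // => i _.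
have [|/cJ->] := boolP (i \in J); last by rewrite mul0r.
by rewrite inE => /andP[_ /eqP->]; rewrite mulr0.
Qed.

Lemma cone_on_face n (v : 'M[R]_(n, d)) (I J : {set 'I_n}) :
  indep v I -> J \subset I -> face (cone_on v J) (cone_on v I).
Proof.
(* The supporting functional is 0 on the generators in J and 1 on the other ones of I. *)
move=> vI JI; have [u uE] := indep_dual (fun i => (i \notin J)%:R) vI.
have cE (c : 'rV[R]_n) : (forall i, i \notin I -> c 0 i = 0) ->
    (c *m v *m u) 0 0 = \sum_(i | i \notin J) c 0 i.
  move=> cI; rewrite coneM_sum [RHS]big_mkcond; apply: eq_bigr => i _.
  have [iI|/cI->] := boolP (i \in I); last by rewrite mul0r if_same.
  by rewrite uE //; case: (i \in J); rewrite ?mulr0 ?mulr1.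
exists u; split=> [_ [c [c0 cI] <-]|]; first by rewrite cE // sumr_ge0.
apply/seteqP; split=> x.
  move=> xJ; split; first exact: cone_on_subset xJ.
  move: xJ => [c [c0 cJ] <-]; rewrite cE ?big1 // => i iI; apply: cJ => //.
  by apply: contra iI; exact: (fintype.subsetP JI).
move=> [[c [c0 cI] <-]]; rewrite cE // => /psumr_eq0P cJ0.
by exists c => //; split=> // i iJ; apply: cJ0.
Qed.

Lemma cone_dim_on n (v : 'M[R]_(n, d)) (I : {set 'I_n}) k :
  indep v I -> cone_dim (cone_on v I) k <-> k = #|I|.
Proof.
move=> vI; have vf := rows_in_free vI.
have sub x : cone_on v I x -> (x <= rows_in v I)%MS.
  by rewrite -cone_of_rows_in => -[c _ <-]; exact: submxMl.
have rowin i : cone_on v I (row i (rows_in v I)).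
  rewrite -cone_of_rows_in; apply: cone_on_row; rewrite inE //.
split=> [[w [wf ws sw]]|->]; last by exists (rows_in v I).
have -> : k = \rank w by apply/esym/eqP.
have -> : #|I| = \rank (rows_in v I) by apply/esym/eqP.
apply/eqP; rewrite eqn_leq !mxrankS //; apply/row_subP => i; [exact: sw|exact: sub].
Qed.

Lemma ray_cone_on n (v : 'M[R]_(n, d)) i : ray (row i v) = cone_on v [set i].
Proof.
have -> : row i v = rowsub (fun _ : 'I_1 => i) v.
  by apply/rowP => j; rewrite !mxE.
rewrite /ray /cone_of cone_on_rowsub; last by move=> j j' _; rewrite !ord1.
congr cone_on; apply/setP => j; apply/imsetP/set1P => [[k _ ->]//|->].
by exists 0.
Qed.

Lemma indepW n (v : 'M[R]_(n, d)) (I J : {set 'I_n}) :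
  J \subset I -> indep v I -> indep v J.
Proof.
move=> /fintype.subsetP JI vI c cJ; apply: vI => i iI.
by apply: cJ; apply: contra iI; exact: JI.
Qed.

Lemma cone_rays n (v : 'M[R]_(n, d)) (I : {set 'I_n}) : indep v I ->
  [set t | face t (cone_on v I) /\ cone_dim t 1] =
  [set ray (row i v) | i in [set i | i \in I]].
Proof.
move=> vI; apply/seteqP; split=> [t [/face_cone_on[J JI ->]]|_ [i /= iI <-]].
  move=> /(cone_dim_on _ (indepW JI vI))/esym/eqP/cards1P[i Ji].
  exists i; last by rewrite ray_cone_on Ji.
  by apply: (fintype.subsetP JI); rewrite Ji set11.
have iI1 : [set i]%SET \subset I by rewrite finset.sub1set.
rewrite ray_cone_on; split; first exact: cone_on_face.
by apply/(cone_dim_on _ (indepW iI1 vI)); rewrite cards1.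
Qed.

Lemma ray_eq (x y : 'rV[R]_d) : x != 0 -> ray x = ray y ->
  exists2 l, 0 < l & y = l *: x.
Proof.
move=> x0 xy.
have self (z : 'rV[R]_d) : ray z z.
  have := @cone_on_row _ z [set: 'I_1]%SET 0; rewrite inE => /(_ isT).
  by rewrite row_id.
have rayP (z t : 'rV[R]_d) : ray z t -> exists2 l, 0 <= l & t = l *: z.
  move=> [c [c0 _] <-]; exists (c 0 0) => //.
  by rewrite [c]mx11_scalar mul_scalar_mx mxE eqxx.
have [l l0 yl] : exists2 l, 0 <= l & y = l *: x by apply: rayP; rewrite xy.
exists l => //; rewrite lt_neqAle l0 andbT; apply: contra x0 => /eqP l00.
have [m _ xm] : exists2 l, 0 <= l & x = l *: y by apply: rayP; rewrite -xy.
by rewrite xm yl -l00 scale0r scaler0.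
Qed.

(** Generators of the same ray differ by a positive factor, so the two families differ by a positive
    diagonal matrix, which preserves both cone and independence. *)
Lemma same_rays k n (w : 'M[R]_(k, d)) (v : 'M[R]_(n, d)) (g : 'I_k -> 'I_n) :
  row_free w -> injective g -> (forall j, ray (row j w) = ray (row (g j) v)) ->
  cone_of w = cone_on v (g @: [set: 'I_k]%SET) /\ indep v (g @: [set: 'I_k]%SET).
Proof.
move=> wf ginj rE.
have w0 j : row j w != 0.
  apply/eqP => wj; have := row_free_inj wf (x1 := delta_mx 0 j) (x2 := 0 : 'rV_k).
  rewrite -rowE wj mul0mx => /(_ erefl)/rowP/(_ j).
  by rewrite !mxE !eqxx => /eqP; rewrite oner_eq0.
have /choice[l lP] : forall j, exists l, 0 < l /\ row (g j) v = l *: row j w.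
  by move=> j; have [l l0 E] := ray_eq (w0 j) (rE j); exists l.
have vE : rowsub g v = diag_mx (\row_j l j) *m w.
  apply/row_matrixP => j; rewrite row_mul row_diag_mx -scalemxAl -rowE mxE.
  by have [_ <-] := lP j; apply/rowP => i; rewrite !mxE.
rewrite -cone_on_rowsub // -indep_rowsub // vE; split.
  apply/seteqP; split=> _ [c [c0 _] <-].
    exists (\row_j (c 0 j / l j)).
      split=> j; last by rewrite inE.
      by rewrite mxE divr_ge0 //; have [/ltW] := lP j.
    rewrite mulmxA; congr (_ *m _); apply/rowP => j; rewrite mul_mx_diag !mxE.
    by rewrite divfK //; have [/lt0r_neq0] := lP j.
  exists (c *m diag_mx (\row_j l j)); last by rewrite mulmxA.
  split=> j; last by rewrite inE.
  by rewrite mul_mx_diag !mxE mulr_ge0 //; have [/ltW] := lP j.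
apply/indep_setT/inj_row_free => c; rewrite mulmxA => E.
have /rowP c0 : c *m diag_mx (\row_j l j) = 0.
  by apply: (row_free_inj wf); rewrite E mul0mx.
apply/rowP => j; have := c0 j; rewrite mul_mx_diag !mxE => /eqP.
by rewrite mulf_eq0 => /orP[/eqP//|/eqP l0]; have [] := lP j; rewrite l0 ltxx.
Qed.

End Cones.

(** * Simplicial fans as families of vectors *)

Section FanRelations.
Variables (R : realType) (d : nat).

(* The rows of v generate a simplicial fan of type E: every element of E is
   independent, and the cones over I and J meet only along I :&: J. *)
Definition fanrel n (v : 'M[R]_(n, d)) (E : {set {set 'I_n}}) : Prop :=
  forall I J, I \in E -> J \in E -> forall c : 'rV[R]_n,
    (forall i, i \in I :\: J -> 0 <= c 0 i) ->
    (forall i, i \in J :\: I -> c 0 i <= 0) ->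
    (forall i, i \notin I :|: J -> c 0 i = 0) -> c *m v = 0 -> c = 0.

Definition type_map k n (f : 'I_k -> 'I_n) (E : {set {set 'I_k}}) :
    {set {set 'I_n}} :=
  [set f @: (I : {set 'I_k}) | I in E]%SET.

Lemma fanrel_indep n (v : 'M[R]_(n, d)) E I : fanrel v E -> I \in E -> indep v I.
Proof.
move=> vE IE c cI cv; apply: (vE I I) => //.
- by move=> i; rewrite finset.setDv inE.
- by move=> i; rewrite finset.setDv inE.
- by move=> i; rewrite finset.setUid; exact: cI.
Qed.

(** Two expressions of a common point differ by a relation with exactly the signs that [fanrel]
    excludes, hence they are equal and supported in both I and J. *)
Lemma fanrel_cap n (v : 'M[R]_(n, d)) (E : {set {set 'I_n}}) I J :
  fanrel v E -> I \in E -> J \in E ->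
  cone_on v I `&` cone_on v J = cone_on v (I :&: J).
Proof.
move=> vE IE JE; apply/seteqP; split=> x; last first.
  by move=> xIJ; split; apply: cone_on_subset xIJ;
    [exact: finset.subsetIl|exact: finset.subsetIr].
move=> [[c [c0 cI] <-] [c' [c'0 c'J] /esym/eqP]].
rewrite -subr_eq0 -mulmxBl => /eqP E0.
have /eqP : c - c' = 0.
  apply: (vE I J) E0 => // i; rewrite !inE !mxE.
  - by case/andP=> /c'J-> _; rewrite subr0.
  - by case/andP=> /cI-> _; rewrite sub0r oppr_le0.
  - by rewrite negb_or => /andP[/cI-> /c'J->]; rewrite subr0.
rewrite subr_eq0 => /eqP cc'; exists c => //; split=> // i.
by rewrite inE negb_and => /orP[/cI//|/c'J]; rewrite cc'.
Qed.

Lemma fanrel_rowsub k n (f : 'I_k -> 'I_n) (v : 'M[R]_(n, d)) E :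
  injective f -> fanrel (rowsub f v) E <-> fanrel v (type_map f E).
Proof.
move=> finj; split=> vE.
  move=> _ _ /imsetP[I IE ->] /imsetP[J JE ->] c cIJ cJI c0 cv.
  have c0' j : j \notin f @: (I :|: J) -> c 0 j = 0.
    by rewrite imsetU; exact: c0.
  have E0 : colsub f c = 0.
    apply: (vE I J) => //.
    - by move=> i; rewrite !inE mxE => H; apply: cIJ; rewrite inE !mem_imset.
    - by move=> i; rewrite !inE mxE => H; apply: cJI; rewrite inE !mem_imset.
    - by move=> i iIJ; rewrite mxE c0' // mem_imset.
    - by rewrite -pushM (push_colsub finj c0').
  by rewrite -(push_colsub finj c0') E0 /push mul0mx.
move=> I J IE JE c cIJ cJI c0 cv.
have fI := imset_f (fun I : {set 'I_k} => f @: I) IE.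
have fJ := imset_f (fun I : {set 'I_k} => f @: I) JE.
have : push f c = 0.
  apply: (vE _ _ fI fJ).
  - move=> j; rewrite inE => /andP[jJ /imsetP[i iI ji]].
    by rewrite ji pushE // cIJ // inE iI andbT; move: jJ; rewrite ji mem_imset.
  - move=> j; rewrite inE => /andP[jI /imsetP[i iJ ji]].
    by rewrite ji pushE // cJI // inE iJ andbT; move: jI; rewrite ji mem_imset.
  - by move=> j; rewrite -imsetU; exact: push_out.
  - by rewrite pushM.
by move=> p0; apply/rowP => i; rewrite -(pushE c i finj) p0 !mxE.
Qed.

Lemma fanrel_mulmx n (v : 'M[R]_(n, d)) E (L : 'M[R]_d) : L \in unitmx ->
  fanrel v E -> fanrel (v *m L) E.
Proof.
move=> uL vE I J IE JE c cIJ cJI c0; rewrite mulmxA => cvL.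
by apply: (vE I J) => //; rewrite -(mulmxK uL (c *m v)) cvL mul0mx.
Qed.

Lemma indep_ray_inj n (v : 'M[R]_(n, d)) (I : {set 'I_n}) i j : indep v I ->
  i \in I -> j \in I -> ray (row i v) = ray (row j v) -> i = j.
Proof.
move=> vI iI jI rE.
have cz l : l *: row i v = row j v ->
    l *: delta_mx 0 i - delta_mx 0 j = 0 :> 'rV[R]_n.
  move=> lE; apply: vI => [k kI|]; last first.
    by rewrite mulmxBl -scalemxAl -!rowE lE subrr.
  have ki (i' : 'I_n) : i' \in I -> (k == i') = false.
    by move=> i'I; apply/eqP => E; rewrite -E (negbTE kI) in i'I.
  by rewrite !mxE !ki // !andbF mulr0 subr0.
have i0 : row i v != 0.
  apply/eqP => vi0.
  have /rowP/(_ i) : delta_mx 0 i = 0 :> 'rV[R]_n.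
    apply: vI => [k kI|]; last by rewrite -rowE.
    by rewrite mxE eqxx /=; case: eqP => // E; rewrite E iI in kI.
  by rewrite !mxE !eqxx => /eqP; rewrite oner_eq0.
have [l _ /esym/cz/rowP/(_ j)] := ray_eq i0 rE.
rewrite !mxE !eqxx /=; case: (eqVneq j i) => [->//|_].
by rewrite mulr0 sub0r => /eqP; rewrite oppr_eq0 oner_eq0.
Qed.

End FanRelations.

(** * From a simplicial fan to relations among its generators *)

Section SimplicialFan.
Variables (R : realType) (d p : nat) (F : quantum_fan R d p).
Hypothesis Fs : simplicial_fan F.
Local Notation v := (qgens F).
Local Notation E := (comb_type F).

Lemma fan_ray_inj : injective (fun k => ray (row k v)).
Proof.
have [_ + _] := qgens_rays F; move=> H i j; apply: H; exact/mem_set.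
Qed.

(** The one-dimensional faces of s are cones of the fan, hence rays of the v_k; [same_rays] then
    replaces the generators of s by the v_k. *)
Lemma fan_cone_repr s : qcones F s -> exists J : {set 'I_p},
  [/\ J \in E, indep v J & s = cone_on v J].
Proof.
move=> Fss; have [k [w [wf sw]]] := Fs Fss.
have wi : indep w [set: 'I_k]%SET by exact/indep_setT.
have rays := cone_rays wi.
have [_ _ surj] := qgens_rays F.
have /choice[g gP] : forall j, exists i, ray (row i v) = ray (row j w).
  move=> j; have [fj dj] : [set t | face t (cone_on w [set: 'I_k]) /\
      cone_dim t 1] (ray (row j w)).
    by rewrite rays; exists j => //=; rewrite inE.
  have [|i _ iE] := surj (ray (row j w)); last by exists i.
  by split=> //; apply: qcones_face Fss _; rewrite sw.
have ginj : injective g.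
  move=> j j' gjj'.
  have E' : ray (row j w) = ray (row j' w) by rewrite -!gP gjj'.
  by apply: (indep_ray_inj wi) E'; rewrite inE.
have [cE vi] := same_rays wf ginj (fun j => esym (gP j)).
exists (g @: [set: 'I_k]%SET); split=> //; last by rewrite sw.
rewrite inE; apply/asboolP; split; first by rewrite -cE -sw.
exact: cone_rays.
Qed.

Lemma same_cone_type (I J : {set 'I_p}) : indep v I -> indep v J ->
  cone_on v I = cone_on v J -> I = J.
Proof.
move=> vI vJ IJ; have := cone_rays vI; rewrite IJ cone_rays // => rE.
by apply/setP => i; apply/idP/idP => iX;
  [have : [set ray (row i v) | i in [set i | i \in I]] (ray (row i v)) by exists i
  |have : [set ray (row i v) | i in [set i | i \in J]] (ray (row i v)) by exists i];
  [rewrite -rE|rewrite rE] => -[j jX /fan_ray_inj <-].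
Qed.

(** Independence is not part of [comb_type]. It comes from the representation of the same cone by an
    independent J, and comparing rays gives I = J. *)
Lemma comb_typeP I : I \in E -> indep v I /\ qcones F (cone_on v I).
Proof.
move=> IE; have := IE; rewrite inE => /asboolP[sF rI]; split=> //.
have [J [JE vJ sJ]] := fan_cone_repr sF.
suff -> : I = J by [].
rewrite sJ cone_rays // in rI.
by apply/setP => i; apply/idP/idP => iX;
  [have : [set ray (row i v) | i in [set i | i \in I]] (ray (row i v)) by exists i
  |have : [set ray (row i v) | i in [set i | i \in J]] (ray (row i v)) by exists i];
  [rewrite -rI|rewrite rI] => -[j jX /fan_ray_inj <-].
Qed.

Lemma comb_typeE I : indep v I -> qcones F (cone_on v I) -> I \in E.
Proof.
by move=> vI sF; rewrite inE; apply/asboolP; split=> //; exact: cone_rays.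
Qed.

Lemma comb_type_sub (I J : {set 'I_p}) : J \subset I -> I \in E -> J \in E.
Proof.
move=> JI /comb_typeP[vI sF]; apply: comb_typeE (indepW JI vI) _.
by apply: qcones_face sF _; exact: cone_on_face.
Qed.

Lemma comb_type1 k : [set k]%SET \in E.
Proof.
have [fun_ _ _] := qgens_rays F.
have [sF] : qcones F (ray (row k v)) /\ cone_dim (ray (row k v)) 1.
  by have := fun_ k I.
have [J [JE vJ sJ]] := fan_cone_repr sF.
rewrite sJ => /(cone_dim_on _ vJ)/esym/eqP/cards1P[i Ji].
rewrite Ji -ray_cone_on in sJ; have ki := fan_ray_inj sJ.
by rewrite ki -Ji.
Qed.

Lemma comb_type0 : finset.set0 \in E.
Proof.
have [J [JE _ _]] := fan_cone_repr (qcones0 F).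
exact: comb_type_sub (finset.sub0set J) JE.
Qed.

(** A relation with the given signs yields one point written over I and over J. It lies in the
    common face of the two cones, which is the cone over a single I' contained in both; uniqueness
    of coordinates makes the two expressions equal, so the relation is trivial. *)
Lemma comb_type_fanrel : fanrel v E.
Proof.
move=> I J IE JE c cIJ cJI c0 cv.
have [[vI sI] [vJ sJ]] := (comb_typeP IE, comb_typeP JE).
(* On I :&: J the sign of c is unknown; adding the absolute value to both parts makes them
   nonnegative and keeps the difference. *)
pose a : 'rV[R]_p := \row_i (if i \in I then
  if i \in J then `|c 0 i| + c 0 i else c 0 i else 0).
pose b : 'rV[R]_p := \row_i (if i \in J then
  if i \in I then `|c 0 i| else - c 0 i else 0).
have cE : c = a - b.
  apply/rowP => i; rewrite !mxE.
  case: ifPn => iI; case: ifPn => iJ; rewrite ?subr0 ?sub0r ?opprK //.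
    by rewrite addrC addKr.
  by rewrite c0 // inE negb_or iI iJ.
have a0 i : 0 <= a 0 i.
  rewrite mxE; case: ifPn => // iI; case: ifPn => iJ.
    by rewrite -lerBlDr sub0r ler_normr lexx orbT.
  by apply: cIJ; rewrite inE iI iJ.
have b0 i : 0 <= b 0 i.
  rewrite mxE; case: ifPn => // iJ; case: ifPn => iI //.
  by rewrite oppr_ge0; apply: cJI; rewrite inE iI iJ.
have aI i : i \notin I -> a 0 i = 0 by move=> iI; rewrite mxE (negbTE iI).
have bJ i : i \notin J -> b 0 i = 0 by move=> iJ; rewrite mxE (negbTE iJ).
have ab : a *m v = b *m v by apply/eqP; rewrite -subr_eq0 -mulmxBl -cE cv.
have [tF /face_cone_on[I' I'I tI] /face_cone_on[J' J'J tJ]] := qcones_cap sI sJ.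
have I'J' : I' = J'.
  by apply: same_cone_type; rewrite -?tI ?tJ //; [exact: indepW vI|exact: indepW vJ].
have : (cone_on v I `&` cone_on v J) (a *m v).
  by split; [exists a|rewrite ab; exists b].
rewrite tI => -[e [e0 eI'] ev].
have uniq (K : {set 'I_p}) (x : 'rV[R]_p) : indep v K -> I' \subset K ->
    (forall i, i \notin K -> x 0 i = 0) -> e *m v = x *m v -> x = e.
  move=> vK I'K xK exv; apply/esym/eqP; rewrite -subr_eq0; apply/eqP/vK.
    move=> i iK; rewrite !mxE xK // eI' ?subr0 //.
    by apply: contra iK; exact: (fintype.subsetP I'K).
  by rewrite mulmxBl exv subrr.
rewrite cE (uniq I a) // (uniq J b) ?subrr // ?I'J' //.
by rewrite ev ab.
Qed.

End SimplicialFan.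

(** * From relations back to a simplicial fan *)

Section FanOfType.
Variables (R : realType) (d p : nat) (v : 'M[R]_(p, d)) (E : {set {set 'I_p}}).
Hypothesis vE : fanrel v E.
Hypothesis E_sub : forall I J : {set 'I_p}, J \subset I -> I \in E -> J \in E.
Hypothesis E0 : finset.set0 \in E.
Hypothesis E1 : forall k, [set k]%SET \in E.
Variable G : set 'rV[R]_d.
Hypothesis G_fg : fg_subgroup G.
Hypothesis G_span : lin_span G = setT.
Hypothesis G_gens : forall k, G (row k v).

Definition type_cones : set (set 'rV[R]_d) :=
  [set cone_on v I | I in [set I | I \in E]].

Lemma type_cones_gen s : type_cones s -> exists k (w : 'M[R]_(k, d)),
  (forall i, G (row i w)) /\ s = cone_of w.
Proof.
move=> [I IE <-]; exists #|I|, (rows_in v I); rewrite cone_of_rows_in; split=> // i.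
have -> : row i (rows_in v I) = row (enum_val i) v by apply/rowP => j; rewrite !mxE.
exact: G_gens.
Qed.

Lemma type_cones_sc s : type_cones s -> strongly_convex s.
Proof.
move=> [I IE <-] _ [c [c0 cI] <-] [c' [c'0 c'I] cc'].
have /(fanrel_indep vE IE) : forall i, i \notin I -> (c + c') 0 i = 0.
  by move=> i iI; rewrite mxE cI // c'I // addr0.
rewrite mulmxDl cc' subrr => /(_ erefl)/rowP cc0.
have -> : c = 0; last by rewrite mul0mx.
apply/rowP => i; have := cc0 i; rewrite !mxE => /eqP.
by rewrite paddr_eq0 // => /andP[/eqP].
Qed.

Lemma cone_on0 : cone_on v finset.set0 = [set 0].
Proof.
apply/seteqP; split=> [_ [c [_ c0] <-]|_ ->].
  by have -> : c = 0; [apply/rowP => i; rewrite mxE c0 ?inE|rewrite /= mul0mx].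
by exists 0; [split=> i; rewrite mxE|rewrite mul0mx].
Qed.

Lemma type_cones0 : type_cones [set 0].
Proof. by exists finset.set0 => //; exact: cone_on0. Qed.

Lemma type_cones_face s t : type_cones s -> face t s -> type_cones t.
Proof.
by move=> [I IE <-] /face_cone_on[J JI ->]; exists J => //; exact: E_sub JI IE.
Qed.

Lemma type_cones_cap s t : type_cones s -> type_cones t ->
  [/\ type_cones (s `&` t), face (s `&` t) s & face (s `&` t) t].
Proof.
move=> [I IE <-] [J JE <-]; rewrite (fanrel_cap vE) //.
have [IJI IJJ] := (finset.subsetIl I J, finset.subsetIr I J).
split; first by exists (I :&: J) => //; exact: E_sub IJI IE.
  exact: cone_on_face (fanrel_indep vE IE) _.
exact: cone_on_face (fanrel_indep vE JE) _.
Qed.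

Lemma type_cones_rays : set_bij [set: 'I_p]
  [set s | type_cones s /\ cone_dim s 1] (fun k => ray (row k v)).
Proof.
have vi k := fanrel_indep vE (E1 k).
split.
- move=> k _ /=; rewrite ray_cone_on; split.
    by exists [set k]%SET => //=; exact: E1.
  by apply/(cone_dim_on _ (vi k)); rewrite cards1.
- move=> i j _ _; rewrite !ray_cone_on => ij.
  apply/eqP; apply/negPn/negP => nij.
  (* If two rays were equal, this one-dimensional cone would be the cone over the empty set. *)
  have := fanrel_cap vE (E1 i) (E1 j).
  rewrite ij setIid.
  have -> : ([set i] :&: [set j])%SET = finset.set0 :> {set 'I_p}.
    by apply/setP => k; rewrite !inE; case: (eqVneq k i) => // ->; rewrite (negbTE nij).
  move=> /(congr1 (fun s => cone_dim s 1))/= E'.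
  have : cone_dim (cone_on v [set j]) 1 by apply/(cone_dim_on _ (vi j)); rewrite cards1.
  by rewrite E' => /(cone_dim_on _ (fanrel_indep vE E0)); rewrite cards0.
- move=> _ [[I IE <-]] /(cone_dim_on _ (fanrel_indep vE IE))/esym/eqP/cards1P[k Ik].
  by exists k => //; rewrite ray_cone_on Ik.
Qed.

Definition fan_of_type : quantum_fan R d p :=
  QuantumFan G_fg G_span type_cones_gen type_cones_sc type_cones0
    type_cones_face type_cones_cap G_gens type_cones_rays.

Lemma fan_of_type_simplicial : simplicial_fan fan_of_type.
Proof.
move=> _ [I IE <-]; exists #|I|, (rows_in v I); rewrite cone_of_rows_in.
by split=> //; apply: rows_in_free; exact: fanrel_indep IE.
Qed.

Lemma fan_of_type_comb : comb_type fan_of_type = E.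
Proof.
apply/setP => I; apply/idP/idP => [|IE].
  move=> IC; have [vI [J /= JE JI]] := comb_typeP fan_of_type_simplicial IC.
  suff -> : I = J by [].
  apply: (same_cone_type (F := fan_of_type)) vI _ (esym JI).
  exact: fanrel_indep JE.
apply: comb_typeE; first exact: fanrel_indep IE.
by exists I.
Qed.

End FanOfType.

(** * Isomorphisms of calibrated fans *)

Lemma type_mapP k n (f : 'I_k -> 'I_n) (E : {set {set 'I_k}}) I :
  reflect (exists2 J : {set 'I_k}, J \in E & I = f @: J) (I \in type_map f E).
Proof. exact: imsetP. Qed.

Lemma type_map_comp k n m (f : 'I_k -> 'I_n) (g : 'I_n -> 'I_m) E :
  type_map g (type_map f E) = type_map (g \o f) E.
Proof.
rewrite /type_map -imset_comp; apply: eq_imset => I /=.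
by rewrite -imset_comp.
Qed.

Lemma type_map_id n (E : {set {set 'I_n}}) : type_map id E = E.
Proof.
rewrite /type_map -[RHS]imset_id; apply: eq_imset => I /=; exact: imset_id.
Qed.

Lemma type_map_eq k n (f g : 'I_k -> 'I_n) E :
  f =1 g -> type_map f E = type_map g E.
Proof. by move=> fg; apply: eq_imset => I; exact: eq_imset. Qed.

Lemma delta_perm n (s : {perm 'I_n}) i :
  delta_mx 0 i *m perm_mx s = delta_mx 0 (s i) :> 'rV[int]_n.
Proof. by rewrite -rowE; apply/rowP => j; rewrite !mxE eqxx eq_sym. Qed.

Section CalFans.
Variables (R : realType) (d n p : nat).
Implicit Types F : cal_fan R d n p.

Definition fmx F : 'M[R]_(n, d) := \matrix_i calib F (delta_mx 0 i).

(** The type on all n indices. Its singletons are those of I_0 by [ftype1], so for fans of maximal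
    length it determines J too. *)
Definition ftype F : {set {set 'I_n}} := type_map (cidx F) (comb_type F).

Lemma row_fmx F i : row i (fmx F) = calib F (delta_mx 0 i).
Proof. exact: rowK. Qed.

Lemma calibE F x : calib F x = map_mx intr x *m fmx F.
Proof.
rewrite [in LHS](row_sum_delta x) raddf_sum mulmx_sum_row; apply: eq_bigr => i _.
by rewrite row_fmx mxE scaler_int -raddfMz -scaler_int intz.
Qed.

Lemma qgens_fmx F : qgens F = rowsub (cidx F) (fmx F).
Proof. by apply/row_matrixP => k; rewrite row_rowsub row_fmx cidx_gens. Qed.

Lemma ftypeP F I : simplicial_fan F -> I \in ftype F <->
  [/\ exists J : {set 'I_p}, I = cidx F @: J, indep (fmx F) I &
      qcones F (cone_on (fmx F) I)].
Proof.
move=> sF; have cinj := @cidx_inj _ _ _ _ F.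
split=> [/type_mapP[J JE ->]|[[J ->]]].
  have [vJ qJ] := comb_typeP sF JE.
  split; first by exists J.
    by apply/indep_rowsub; rewrite -?qgens_fmx.
  by rewrite -cone_on_rowsub // -qgens_fmx.
move=> /(indep_rowsub _ _ cinj); rewrite -cone_on_rowsub // -qgens_fmx => vJ qJ.
by apply/type_mapP; exists J => //; exact: comb_typeE.
Qed.

Lemma ftype_conesP F s : simplicial_fan F -> qcones F s ->
  exists2 I, I \in ftype F & s = cone_on (fmx F) I.
Proof.
move=> sF /(fan_cone_repr sF)[J [JE _ ->]]; exists (cidx F @: J).
  by apply/type_mapP; exists J.
by rewrite qgens_fmx cone_on_rowsub //; exact: cidx_inj.
Qed.

Lemma ftype_cone_inj F I J : simplicial_fan F -> I \in ftype F ->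
  J \in ftype F -> cone_on (fmx F) I = cone_on (fmx F) J -> I = J.
Proof.
move=> sF /type_mapP[I' IE ->] /type_mapP[J' JE ->].
have cinj := @cidx_inj _ _ _ _ F.
rewrite -!cone_on_rowsub // -qgens_fmx => IJ.
have [vI _] := comb_typeP sF IE; have [vJ _] := comb_typeP sF JE.
by rewrite (same_cone_type vI vJ IJ).
Qed.

Lemma ftype1 F i : simplicial_fan F ->
  ([set i]%SET \in ftype F) <-> exists k, i = cidx F k.
Proof.
move=> sF; split=> [/type_mapP[J _ iJ]|[k ->]].
  have : i \in [set i]%SET by rewrite inE.
  by rewrite iJ => /imsetP[k _ ->]; exists k.
apply/type_mapP; exists [set k]%SET; first exact: comb_type1.
by rewrite imset_set1.
Qed.

Lemma ftype_fanrel F : simplicial_fan F -> fanrel (fmx F) (ftype F).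
Proof.
move=> sF; apply/fanrel_rowsub; first exact: cidx_inj.
by rewrite -qgens_fmx; exact: comb_type_fanrel.
Qed.

Lemma image_cone_on k (v : 'M[R]_(k, d)) (L : 'M[R]_d) I :
  [set x *m L | x in cone_on v I] = cone_on (v *m L) I.
Proof.
apply/seteqP; split=> [_ [_ [c cI <-] <-]|_ [c cI <-]].
  by exists c => //; rewrite mulmxA.
by exists (c *m v); [exists c|rewrite mulmxA].
Qed.

Lemma indep_mulmx k (v : 'M[R]_(k, d)) (L : 'M[R]_d) I : L \in unitmx ->
  indep v I -> indep (v *m L) I.
Proof.
move=> uL vI c cI; rewrite mulmxA => E; apply: vI => //.
by rewrite -(mulmxK uL (c *m v)) E mul0mx.
Qed.

(* An isomorphism, seen on the family of all n generators. *)
Definition niso F F' : Prop :=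
  exists (L : 'M[R]_d) (s : {perm 'I_n}),
    [/\ L \in unitmx, ftype F' = type_map s (ftype F) &
        fmx F *m L = rowsub s (fmx F')].

Lemma niso_refl F : niso F F.
Proof.
exists 1%:M, 1%g; split; first exact: unitmx1.
  by rewrite -[LHS]type_map_id; apply: type_map_eq => i; rewrite perm1.
by rewrite mulmx1; apply/matrixP => i j; rewrite !mxE perm1.
Qed.

Lemma niso_sym F F' : niso F F' -> niso F' F.
Proof.
move=> [L [s [uL sT sL]]]; exists (invmx L), (s^-1)%g; split.
- by rewrite unitmx_inv.
- rewrite sT type_map_comp -[LHS]type_map_id.
  by apply: type_map_eq => i; rewrite /= permK.
- have -> : fmx F = rowsub s (fmx F' *m invmx L).
    by rewrite -mul_rowsub_mx -sL mulmxK.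
  by apply/matrixP => i j; rewrite [RHS]mxE [RHS]mxE permKV.
Qed.

Lemma niso_trans F F' F'' : niso F F' -> niso F' F'' -> niso F F''.
Proof.
move=> [L [s [uL sT sL]]] [L' [s' [uL' sT' sL']]].
exists (L *m L'), (s * s')%g; split.
- by rewrite unitmx_mul uL.
- rewrite sT' sT type_map_comp.
  by apply: type_map_eq => i; rewrite /= permM.
- rewrite mulmxA sL mul_rowsub_mx sL'.
  by apply/matrixP => i j; rewrite !mxE permM.
Qed.

Lemma cal_iso_niso F F' : simplicial_fan F -> simplicial_fan F' ->
  cal_iso F F' -> niso F F'.
Proof.
move=> sF sF' [L [H [[uL _] [qL _ qsurj] _ [/is_perm_mxP[s ->] rs _] calL]]].
have sE : fmx F *m L = rowsub s (fmx F').
  by apply/row_matrixP => i; rewrite row_mul row_rowsub !row_fmx calL delta_perm.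
have s_cone I : [set x *m L | x in cone_on (fmx F) I] =
    cone_on (fmx F') (s @: I).
  by rewrite image_cone_on sE cone_on_rowsub //; exact: perm_inj.
have s_idx k : exists k', s (cidx F k) = cidx F' k'.
  have : basis_vectors (range (cidx F')) (delta_mx 0 (s (cidx F k))).
    by rewrite -rs; exists (delta_mx 0 (cidx F k)); [exists (cidx F k)|exact: delta_perm].
  move=> [_ [k' _ <-] /rowP/(_ (cidx F' k'))]; rewrite !mxE !eqxx /=.
  by case: eqP => [<-|_ /eqP]; [exists k'|rewrite oner_eq0].
have /choice[t tE] := s_idx.
have sT I : I \in ftype F -> s @: I \in ftype F'.
  move=> IT; have /(ftypeP _ sF)[[J IJ] vI qI] := IT.
  apply/(ftypeP _ sF'); split.
  - exists (t @: J); rewrite IJ -!imset_comp; apply: eq_imset => k /=; exact: tE.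
  - apply/indep_rowsub; first exact: perm_inj.
    by rewrite -sE; exact: indep_mulmx.
  - by rewrite -s_cone; exact: qL.
exists L, s; split=> //; apply/setP => I; apply/idP/type_mapP; last first.
  by move=> [J JT ->]; exact: sT.
(* Conversely, the cone over I is the image of a cone of F, and a cone determines its index set. *)
move=> IT; have /(ftypeP _ sF')[_ _ qI] := IT.
have [s0 q0 s0E] := qsurj _ qI.
have [J JT JE] := ftype_conesP sF q0.
exists J => //; apply: (ftype_cone_inj sF') => //; first exact: sT.
by rewrite -s0E JE s_cone.
Qed.

(** By counting: J avoids I_0 and has n - p elements. *)
Lemma cvirtE F : maximal_length F -> [set i | i \in cvirt F] = ~` range (cidx F).
Proof.
move=> mF.
have rE : cvirt F = ~: (cidx F @: [set: 'I_p]%SET).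
  apply/eqP; rewrite eqEcard; apply/andP; split.
    apply/fintype.subsetP => i iv; rewrite !inE; apply/imsetP => -[k _ ik].
    by move: iv; rewrite ik (negbTE (@cidx_virt _ _ _ _ F k)).
  rewrite mF cardsCs finset.setCK card_imset; last exact: cidx_inj.
  by rewrite cardsT !card_ord.
apply/seteqP; split=> i /=; rewrite rE !inE.
  by move=> /imsetP iI [k _ ki]; apply: iI; exists k => //; rewrite inE.
by move=> iI; apply/imsetP => -[k _ ik]; apply: iI; exists k.
Qed.

Lemma niso_cal_iso F F' : simplicial_fan F -> simplicial_fan F' ->
  maximal_length F -> maximal_length F' -> niso F F' -> cal_iso F F'.
Proof.
move=> sF sF' mF mF' [L [s [uL sT sL]]].
have s_cone I : [set x *m L | x in cone_on (fmx F) I] =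
    cone_on (fmx F') (s @: I).
  by rewrite image_cone_on sL cone_on_rowsub //; exact: perm_inj.
have Linj : injective (fun x : 'rV[R]_d => x *m L).
  by move=> x y /(congr1 (mulmx^~ (invmx L))); rewrite !mulmxK.
have calL x : calib F x *m L = calib F' (x *m perm_mx s).
  rewrite !calibE -mulmxA sL map_mxM map_perm_mx -mulmxA; congr (_ *m _).
  by rewrite -row_permE; apply/matrixP => i j; rewrite !mxE.
(* The permutation respects the singletons of the types, hence carries I_0 to I_0'. *)
have /choice[t tE] : forall k, exists k', s (cidx F k) = cidx F' k'.
  move=> k; apply/(ftype1 _ sF'); rewrite sT; apply/type_mapP.
  exists [set cidx F k]%SET; last by rewrite imset_set1.
  by apply/(ftype1 _ sF); exists k.
have tinj : injective t.
  move=> k k' tkk'; apply: (@cidx_inj _ _ _ _ F); apply: (@perm_inj _ s).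
  by rewrite !tE tkk'.
have rs : s @` range (cidx F) = range (cidx F').
  apply/seteqP; split=> [_ [_ [k _ <-] <-]|_ [k' _ <-]].
    by rewrite tE; exists (t k).
  have [t' tK t'K] := injF_bij tinj.
  by exists (cidx F (t' k')); [exists (t' k')|rewrite tE t'K].
have basis_s (X Y : set 'I_n) : s @` X = Y ->
    [set x *m perm_mx s | x in basis_vectors X] = basis_vectors Y.
  move=> <-; apply/seteqP; split=> [_ [_ [i Xi <-] <-]|_ [_ [i Xi <-] <-]].
    by rewrite delta_perm; exists (s i) => //; exists i.
  by exists (delta_mx 0 i); [exists i|exact: delta_perm].
exists L, (perm_mx s); split.
- split=> //; rewrite -!calib_epi; apply/seteqP; split.
    by move=> _ [_ [x _ <-] <-]; rewrite calL; exists (x *m perm_mx s).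
  move=> _ [x _ <-]; exists (calib F (x *m perm_mx s^-1)); first by eexists.
  by rewrite calL -mulmxA -perm_mxM mulVg perm_mx1 mulmx1.
- split.
  + move=> s0 /(ftype_conesP sF)[I IT ->]; rewrite s_cone.
    have : s @: I \in ftype F' by rewrite sT; apply/type_mapP; exists I.
    by case/(ftypeP _ sF').
  + move=> s0 s1 _ _ /= E; apply/seteqP; split=> x sx.
      have : [set x *m L | x in s1] (x *m L) by rewrite -E; exists x.
      by move=> [y s1y /Linj <-].
    have : [set x *m L | x in s0] (x *m L) by rewrite E; exists x.
    by move=> [y s0y /Linj <-].
  + move=> s0 /(ftype_conesP sF')[I IT ->].
    have := IT; rewrite sT => /type_mapP[J JT IJ].
    exists (cone_on (fmx F) J); first by have /(ftypeP _ sF)[] := JT.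
    by rewrite /= s_cone IJ.
- exists (perm tinj) => k; rewrite permE !qgens_fmx !row_rowsub -tE.
  by rewrite -row_mul sL row_rowsub.
- split; first exact: perm_mx_is_perm.
    exact: basis_s.
  apply: basis_s; rewrite !cvirtE // -rs; apply/seteqP; split=> i.
    by move=> [j jr <-] [j' j'r /perm_inj E]; apply: jr; rewrite -E.
  move=> ir; exists (s^-1%g i); rewrite ?permKV // => sr; apply: ir.
  by exists (s^-1%g i); rewrite ?permKV.
- exact: calL.
Qed.

End CalFans.

(** * Smooth families of matrices, and openness of the fan condition *)

Section MatrixCk.
Variables (R : realType) (m : nat) (U : set 'rV[R]_m).
Hypothesis oU : open U.

Definition Ckm k a b (M : 'rV[R]_m -> 'M[R]_(a, b)) : Prop :=
  forall i j, Ckr k U (fun x => M x i j).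

Lemma Ckm_mul k a b c (M : 'rV[R]_m -> 'M[R]_(a, b))
    (N : 'rV[R]_m -> 'M[R]_(b, c)) :
  Ckm k M -> Ckm k N -> Ckm k (fun x => M x *m N x).
Proof.
move=> CM CN i j; under eq_fun do rewrite mxE.
by apply: Ckr_sum => // l; exact: CkrM.
Qed.

Lemma Ckm_det k a (M : 'rV[R]_m -> 'M[R]_a) : Ckm k M ->
  Ckr k U (fun x => \det (M x)).
Proof.
move=> CM; apply: Ckr_sum => // s; apply: CkrM => //; first exact: Ckr_cst.
by apply: Ckr_prod => // i; exact: CM.
Qed.

(** Cramer's formula: the inverse is the adjugate divided by the determinant. *)
Lemma Ckm_inv k a (M : 'rV[R]_m -> 'M[R]_a) :
  (forall x, U x -> M x \in unitmx) -> Ckm k M -> Ckm k (fun x => invmx (M x)).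
Proof.
move=> uM CM i j.
have CD : Ckr k U (fun x => (\det (M x))^-1 * (\adj (M x)) i j).
  apply: CkrM => //.
    apply: CkrV => //; last exact: Ckm_det.
    by move=> x /uM; rewrite unitmxE unitfE.
  under eq_fun do rewrite mxE; apply: CkrM => //; first exact: Ckr_cst.
  apply: Ckm_det => i' j'; under eq_fun do rewrite !mxE; exact: CM.
apply: Ckr_ext CD => // x /uM ux.
by rewrite /invmx ux [RHS]mxE.
Qed.

Lemma Ckm_mxvec a b (M : 'rV[R]_m -> 'M[R]_(a, b)) :
  (forall k, Ckm k M) -> Cinf U (fun x => mxvec (M x)).
Proof.
move=> CM k; apply/CkP => // j; case/mxvec_indexP: j => i j.
by under eq_fun do rewrite mxvecE; exact: CM.
Qed.

End MatrixCk.

(** * Openness of the fan condition *)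

Section FanrelOpen.
Variables (R : realType) (d n : nat).

Lemma mulmx_continuous (cv : 'rV[R]_n * 'M[R]_(n, d)) j :
  {for cv, continuous (fun cv : 'rV[R]_n * 'M[R]_(n, d) => (cv.1 *m cv.2) 0 j)}.
Proof.
rewrite /prop_for /continuous_at mxE; under eq_cvg do rewrite mxE.
apply: cvg_big => [|i _]; first exact: add_continuous.
apply: cvgM.
  apply: (@continuous_comp _ _ _ fst (fun c : 'rV[R]_n => c 0 i)).
    exact: cvg_fst.
  exact: coord_continuous.
apply: (@continuous_comp _ _ _ snd (fun v : 'M[R]_(n, d) => v i j)).
  exact: cvg_snd.
exact: coord_continuous.
Qed.

(** For fixed I and J the sign conditions cut out a closed set S stable under positive scaling, so a
    nontrivial relation may be taken of norm 1. On the compact set K of such coefficients, c *m v !=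
    0 persists for v' near v uniformly in c; there are finitely many pairs I, J. *)
Lemma fanrel_open (E : {set {set 'I_n}}) :
  open [set v : 'M[R]_(n, d) | fanrel v E].
Proof.
pose S (I J : {set 'I_n}) : set 'rV[R]_n := [set c |
  [/\ forall i, i \in I :\: J -> 0 <= c 0 i, forall i, i \in J :\: I -> c 0 i <= 0 &
      forall i, i \notin I :|: J -> c 0 i = 0]].
pose K I J := S I J `&` [set c | `|c| = 1].
have cK I J : compact (K I J).
  apply: bounded_closed_compact.
    exists 1; split=> // x x1 c [_ /= c1]; rewrite c1; exact: ltW.
  apply: closedI; last first.
    apply: preimage_closed (@closed_eq R 1) => c _.
    exact: norm_continuous.
  pose Q i : set R := [set y | [/\ i \in I :\: J -> 0 <= y,
    i \in J :\: I -> y <= 0 & i \notin I :|: J -> y = 0]].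
  have -> : S I J = \bigcap_(i in setT) [set c | Q i (c 0 i)].
    apply/seteqP; split=> [c [c1 c2 c3] i _|c H].
      by split; [exact: c1|exact: c2|exact: c3].
    by split=> i; have [? ? ?] := H i Logic.I.
  apply: closed_bigI => i _; apply: (@preimage_closed _ _ (fun c : 'rV[R]_n => c 0 i)).
    by move=> c _; exact: coord_continuous.
  have cT := @closedT R.
  have -> : Q i = [set y | i \in I :\: J -> 0 <= y] `&`
      [set y | i \in J :\: I -> y <= 0] `&` [set y | i \notin I :|: J -> y = 0].
    by apply/seteqP; split=> [y []|y [[]]].
  have imp (b : bool) (X : set R) : closed X -> closed [set y | b -> X y].
    case: b => cX; last by have -> : [set y | false -> X y] = setT by apply/seteqP; split.
    have -> : [set y | true -> X y] = X.
      by apply/seteqP; split=> y /= => [H|Xy _] //; exact: H.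
    by [].
  by do 2?apply: closedI; apply: imp;
    [exact: closed_ge|exact: closed_le|exact: closed_eq].
have near_K I J (v : 'M[R]_(n, d)) : (forall c, K I J c -> c *m v != 0) ->
    \forall v' \near v, K I J `<=` [set c | c *m v' != 0].
  move=> H; apply: ((compact_near_coveringP _).1 (cK I J) _ (nbhs v)
    (fun v' c => c *m v' != 0) (nbhs_filter v)) => c cIJ.
  have /matrix0Pn[i0 [j]] := H c cIJ; rewrite ord1 => cv0.
  have : \forall cv \near (c, v), (cv.1 *m cv.2) 0 j != 0.
    apply: (@mulmx_continuous (c, v) j [set y | y != 0]).
    apply: open_nbhs_nbhs; split => //; exact: open_neq.
  apply: filterS => -[c' v'] /=; apply: contra => /eqP ->.
  by rewrite mxE.
have KP I J (v : 'M[R]_(n, d)) : (forall c, K I J c -> c *m v != 0) <->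
    (forall c, S I J c -> c *m v = 0 -> c = 0).
  split=> [H c [c1 c2 c3] cv|H c [Sc /= c1]]; last first.
    apply/eqP => /(H c Sc) c0.
    by move: c1; rewrite c0 normr0 => /esym/eqP; rewrite oner_eq0.
  apply/eqP; apply: contraT => c0; have nc : 0 < `|c|^-1 by rewrite invr_gt0 normr_gt0.
  have /negP[] : (`|c|^-1 *: c) *m v != 0.
    apply: H; split; last first.
      by rewrite /= normrZ ger0_norm ?mulVf ?normr_eq0 // ltW.
    split=> i iX; rewrite mxE.
    - by rewrite pmulr_rge0 // c1.
    - by rewrite pmulr_rle0 // c2.
    - by rewrite c3 // mulr0.
  by rewrite -scalemxAl cv scaler0.
rewrite openE => v vE; rewrite /interior.
pose good (IJ : {set 'I_n} * {set 'I_n}) (v' : 'M[R]_(n, d)) :=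
  IJ.1 \in E -> IJ.2 \in E -> K IJ.1 IJ.2 `<=` [set c | c *m v' != 0].
have : \forall v' \near v, forall IJ, good IJ v'.
  apply: (@filter_forall _ _ good (nbhs v) (nbhs_filter v)) => -[I J]; rewrite /good /=.
  have [IE|_] := boolP (I \in E); last by apply: nearW.
  have [JE|_] := boolP (J \in E); last by apply: nearW.
  have /near_K : forall c, K I J c -> c *m v != 0.
    by apply/KP => c [c1 c2 c3]; exact: (vE I J IE JE c c1 c2 c3).
  by apply: filterS => v' Kv' _ _.
apply: filterS => v' Kv' I J IE JE c c1 c2 c3.
by have /KP := Kv' (I, J) IE JE; apply.
Qed.

End FanrelOpen.

(** * The chart given by standard calibrated fans *)

(** List the image of f and then its complement, do the same for g, and match equal positions. *)
Lemma perm_extends k n (f g : 'I_k -> 'I_n) : injective f -> injective g ->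
  exists s : {perm 'I_n}, forall i, s (f i) = g i.
Proof.
move=> finj ginj.
pose l (h : 'I_k -> 'I_n) :=
  [seq h i | i <- enum 'I_k] ++ enum [pred j | j \notin codom h].
have lP h : injective h -> [/\ uniq (l h), size (l h) = n & forall j, j \in l h].
  move=> hinj; have lu : uniq (l h).
    rewrite cat_uniq map_inj_uniq ?enum_uniq //= andbT.
    apply/hasPn => j; rewrite mem_enum inE => jh; apply: contra jh.
    by move=> /mapP[i _ ->]; exact: codom_f.
  have lm j : j \in l h.
    by rewrite mem_cat mem_enum inE; case: (boolP (j \in codom h)).
  split=> //; rewrite -[RHS]card_ord -(card_uniqP lu); apply: eq_card => j.
  by rewrite lm.
have [fu fs fm] := lP f finj; have [gu gs _] := lP g ginj.
have fg : size (l g) = size (l f) by rewrite gs fs.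
pose t (j : 'I_n) := nth j (l g) (index j (l f)).
have tE (j j0 : 'I_n) : t j = nth j0 (l g) (index j (l f)).
  by apply: set_nth_default; rewrite fg index_mem.
have tinj : injective t.
  move=> j j'; rewrite (tE j j) (tE j' j) => /eqP.
  rewrite nth_uniq // ?fg ?index_mem // => /eqP E.
  by rewrite -(nth_index j (fm j)) E nth_index.
exists (perm tinj) => i; rewrite permE /t /l.
have iE : (index i (enum 'I_k) < size (enum 'I_k))%N by rewrite index_mem mem_enum.
rewrite index_cat map_f ?mem_enum // index_map // nth_cat size_map iE.
by rewrite (nth_map i) // nth_index ?mem_enum.
Qed.

Section StandardForm.
Variables (R : realType) (d n : nat).
Hypothesis dn : (d < n)%N.

Definition head_idx : 'I_d -> 'I_n := widen_ord (ltnW dn).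

Lemma tail_idx_subproof (j : 'I_(n - d)) : (d + j < n)%N.
Proof. by rewrite -ltn_subRL. Qed.

Definition tail_idx (j : 'I_(n - d)) : 'I_n := Ordinal (tail_idx_subproof j).

Lemma head_idx_inj : injective head_idx.
Proof. by move=> i j /(congr1 val)/= ij; exact: val_inj. Qed.

Lemma idx_cases (i : 'I_n) :
  (exists j, i = head_idx j) \/ (exists j, i = tail_idx j).
Proof.
have [id|di] := ltnP i d; [left|right].
  by exists (Ordinal id); exact: val_inj.
have idn : (i - d < n - d)%N by rewrite ltn_sub2r.
by exists (Ordinal idn); apply: val_inj; rewrite /= subnKC.
Qed.

(* The n vectors e_1, ..., e_d, hbar(e_(d+1)), ..., hbar(e_n). *)
Definition std (hb : 'M[R]_(n - d, d)) : 'M[R]_(n, d) :=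
  \matrix_(i, j) ((i == j :> nat)%:R +
                  \sum_(k < n - d | i == d + k :> nat) hb k j).

Lemma std_head hb : rowsub head_idx (std hb) = 1%:M.
Proof.
apply/matrixP => i j; rewrite !mxE /= big1 ?addr0 // => k /eqP ik.
by have := ltn_ord i; rewrite ik ltnNge leq_addr.
Qed.

Lemma std_tail hb : rowsub tail_idx (std hb) = hb.
Proof.
apply/matrixP => k j; rewrite !mxE /= (bigD1 k) //= big1 ?addr0.
  by rewrite gtn_eqF ?add0r // (leq_trans (ltn_ord j)) // leq_addr.
by move=> k'; rewrite eqn_add2l eq_sym => /andP[/eqP/val_inj ->]; rewrite eqxx.
Qed.

Lemma std_unique hb v : rowsub head_idx v = 1%:M -> rowsub tail_idx v = hb ->
  v = std hb.
Proof.
move=> v1 vhb; apply/row_matrixP => i.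
case: (idx_cases i) => -[j ->].
  by rewrite -!row_rowsub v1 std_head.
by rewrite -!row_rowsub vhb std_tail.
Qed.

(** The last n - d rows expressed in the basis given by the first d rows. *)
Definition nrm (v : 'M[R]_(n, d)) : 'M[R]_(n - d, d) :=
  rowsub tail_idx v *m invmx (rowsub head_idx v).

Lemma std_nrm v : rowsub head_idx v \in unitmx ->
  std (nrm v) = v *m invmx (rowsub head_idx v).
Proof.
move=> uv; apply/esym/std_unique; first by rewrite -mul_rowsub_mx mulmxV.
by rewrite -mul_rowsub_mx.
Qed.

Lemma nrm_unique v hb : rowsub head_idx v \in unitmx ->
  rowsub tail_idx v = hb *m rowsub head_idx v -> nrm v = hb.
Proof. by move=> uv vE; rewrite /nrm vE mulmxK. Qed.

Lemma nrm_mulmx v (L : 'M[R]_d) : L \in unitmx ->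
  rowsub head_idx v \in unitmx -> nrm (v *m L) = nrm v.
Proof.
move=> uL uv; apply: nrm_unique; rewrite -!mul_rowsub_mx.
  by rewrite unitmx_mul uv.
by rewrite mulmxA mulmxKV.
Qed.

Lemma nrm_std hb : nrm (std hb) = hb.
Proof. by apply: nrm_unique; rewrite std_head ?unitmx1 // mulmx1 std_tail. Qed.

Lemma Ckm_std m (U : set 'rV[R]_m) (hb : 'rV[R]_m -> 'M[R]_(n - d, d)) k :
  open U -> Ckm U k hb -> Ckm U k (fun x => std (hb x)).
Proof.
move=> oU Chb i j; under eq_fun do rewrite mxE.
by apply: CkrD => //; [exact: Ckr_cst|apply: Ckr_sum => // l; exact: Chb].
Qed.

Lemma Ckm_nrm m (U : set 'rV[R]_m) (v : 'rV[R]_m -> 'M[R]_(n, d)) k :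
  open U -> (forall x, U x -> rowsub head_idx (v x) \in unitmx) ->
  Ckm U k v -> Ckm U k (fun x => nrm (v x)).
Proof.
move=> oU uv Cv; apply: Ckm_mul => //.
  by move=> i j; under eq_fun do rewrite mxE; exact: Cv.
apply: Ckm_inv => // i j; under eq_fun do rewrite mxE; exact: Cv.
Qed.

Definition std_calib (hb : 'M[R]_(n - d, d)) (x : 'rV[int]_n) : 'rV[R]_d :=
  map_mx intr x *m std hb.

Lemma std_calib_is_zmod_morphism hb : zmod_morphism (std_calib hb).
Proof. by move=> x y; rewrite /std_calib map_mxB mulmxBl. Qed.

HB.instance Definition _ hb := GRing.isZmodMorphism.Build _ _ (std_calib hb)
  (std_calib_is_zmod_morphism hb).

Lemma std_calib_delta hb i : std_calib hb (delta_mx 0 i) = row i (std hb).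
Proof. by rewrite /std_calib map_delta_mx -rowE. Qed.

Lemma lin_span_std hb (S : set 'rV[R]_d) :
  (forall j, S (row (head_idx j) (std hb))) -> lin_span S = setT.
Proof.
move=> HS; apply/seteqP; split=> // x _; exists d, 1%:M; split; last exact: submx1.
by move=> i; rewrite -(std_head hb) row_rowsub.
Qed.

End StandardForm.

(** * The set W, the group G and the projection to the moduli space *)

Section ModuliChart.
Variables (R : realType) (d n p : nat) (D E0 : {set {set 'I_p}}).
Hypotheses (dn : (d < n)%N) (pn : (p <= n)%N) (dp : (d <= p)%N).
Variable t : {perm 'I_p}.
Hypothesis E0D : E0 = type_map t D.
Hypothesis E0_sub :
  forall I J : {set 'I_p}, J \subset I -> I \in E0 -> J \in E0.
Hypothesis E0_0 : finset.set0 \in E0.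
Hypothesis E0_1 : forall k, [set k]%SET \in E0.
Hypothesis E0_head : [set i : 'I_p | (i < d)%N]%SET \in E0.

Local Notation nrm := (nrm dn).
Local Notation head_idx := (head_idx dn).

Definition gen_idx : 'I_p -> 'I_n := widen_ord pn.

Lemma gen_idx_inj : injective gen_idx.
Proof. by move=> i j /(congr1 val)/= ij; exact: val_inj. Qed.

Definition std_type : {set {set 'I_n}} := type_map gen_idx E0.

Lemma std_type_head (v : 'M[R]_(n, d)) : fanrel v std_type ->
  rowsub head_idx v \in unitmx.
Proof.
move=> vE; rewrite -row_free_unit; apply/indep_setT/indep_rowsub.
  exact: head_idx_inj.
have -> : head_idx @: [set: 'I_d]%SET = gen_idx @: [set i : 'I_p | (i < d)%N]%SET.
  apply/setP => i; apply/imsetP/imsetP => -[j jP ->].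
    exists (widen_ord dp j); first by rewrite inE /=.
    exact: val_inj.
  rewrite inE in jP; exists (Ordinal jP); rewrite ?inE //.
  exact: val_inj.
by apply: fanrel_indep vE _; apply/type_mapP; eexists; first exact: E0_head.
Qed.

Section StandardFan.
Variable hb : 'M[R]_(n - d, d).
Hypothesis hbE : fanrel (std hb) std_type.

Lemma std_gens_fanrel : fanrel (rowsub gen_idx (std hb)) E0.
Proof. by apply/(fanrel_rowsub _ _ gen_idx_inj). Qed.

Lemma std_fg : fg_subgroup (range (std_calib hb)).
Proof. by exists n, (std hb). Qed.

Lemma std_span : lin_span (range (std_calib hb)) = setT.
Proof.
apply: (@lin_span_std _ _ _ dn hb) => j.
by exists (delta_mx 0 (head_idx j)); rewrite ?std_calib_delta.
Qed.

Lemma std_gens k : range (std_calib hb) (row k (rowsub gen_idx (std hb))).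
Proof. by exists (delta_mx 0 (gen_idx k)); rewrite ?std_calib_delta ?row_rowsub. Qed.

Definition std_qfan : quantum_fan R d p := fan_of_type std_gens_fanrel E0_sub
  E0_0 E0_1 std_fg std_span std_gens.

Definition std_virt : {set 'I_n} := [set i : 'I_n | (p <= i)%N]%SET.

Lemma std_virt_span :
  lin_span [set std_calib hb (delta_mx 0 i) | i in [set i | i \notin std_virt]]
    = setT.
Proof.
apply: (@lin_span_std _ _ _ dn hb) => j.
exists (head_idx j); last exact: std_calib_delta.
by rewrite /= inE -ltnNge (leq_trans (ltn_ord j)).
Qed.

Lemma std_idx_virt k : gen_idx k \notin std_virt.
Proof. by rewrite inE -ltnNge; exact: (ltn_ord k). Qed.

Lemma std_idx_gens k : std_calib hb (delta_mx 0 (gen_idx k)) = row k (qgens std_qfan).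
Proof. by rewrite std_calib_delta row_rowsub. Qed.

Definition std_fan : cal_fan R d n p :=
  @CalFan R d n p std_qfan (std_calib hb) erefl std_virt std_virt_span
    gen_idx gen_idx_inj std_idx_virt std_idx_gens.

Lemma std_fan_simplicial : simplicial_fan std_fan.
Proof. exact: fan_of_type_simplicial. Qed.

Lemma std_fan_comb : comb_type std_fan = E0.
Proof. exact: fan_of_type_comb. Qed.

Lemma std_fan_maximal : maximal_length std_fan.
Proof.
rewrite /maximal_length /=.
have -> : std_virt = ~: (gen_idx @: [set: 'I_p]%SET).
  apply/setP => i; rewrite !inE; apply/idP/idP => [pi|].
    apply/imsetP => -[k _ ik].
    by move: pi; rewrite ik /= leqNgt ltn_ord.
  apply: contraR; rewrite -ltnNge => ip.
  by apply/imsetP; exists (Ordinal ip); rewrite ?inE //; exact: val_inj.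
by rewrite cardsCs finset.setCK card_imset ?cardsT ?card_ord //; exact: gen_idx_inj.
Qed.

Lemma std_fan_in_moduli : in_moduli D std_fan.
Proof.
split; [exact: std_fan_simplicial|exact: std_fan_maximal|].
by exists t; rewrite std_fan_comb E0D.
Qed.

Lemma std_fan_fmx : fmx std_fan = std hb.
Proof. by apply/row_matrixP => i; rewrite row_fmx /= std_calib_delta. Qed.

Lemma std_fan_ftype : ftype std_fan = std_type.
Proof. by rewrite /ftype std_fan_comb. Qed.

Lemma std_fan_standard : standard std_fan hb.
Proof.
split=> // i j ij /=; rewrite std_calib_delta.
  have -> : i = head_idx j by exact: val_inj.
  by rewrite -row_rowsub std_head row1.
have -> : i = tail_idx j by exact: val_inj.
by rewrite -row_rowsub std_tail.
Qed.

End StandardFan.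

Lemma standard_fmx (F : cal_fan R d n p) hb : standard F hb -> fmx F = std hb.
Proof.
move=> [F1 F2 _ _]; apply: std_unique; apply/row_matrixP => j.
  by rewrite row_rowsub row_fmx row1 (F1 _ j).
by rewrite row_rowsub row_fmx (F2 _ j).
Qed.

Lemma standard_ftype (F : cal_fan R d n p) hb : standard F hb ->
  ftype F = type_map gen_idx (comb_type F).
Proof.
by move=> [_ _ F3 _]; apply: type_map_eq => k; apply: val_inj; rewrite /= F3.
Qed.

(** Equivalence of types matches only the p generators; the match is extended to the virtual indices
    in an arbitrary way. *)
Lemma exists_relabel (F : cal_fan R d n p) : in_moduli D F ->
  exists s : {perm 'I_n}, type_map s std_type = ftype F.
Proof.
move=> [_ _ [q qE]].
have finj : injective (fun k => cidx F (q (t^-1%g k))).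
  by move=> i j /(@cidx_inj _ _ _ _ F)/perm_inj/perm_inj.
have [s sE] := perm_extends gen_idx_inj finj.
exists s; rewrite /ftype qE -/(type_map q D) /std_type E0D !type_map_comp.
by apply: type_map_eq => k /=; rewrite sE permK.
Qed.

Lemma relabel_fanrel (F : cal_fan R d n p) (s : {perm 'I_n}) :
  simplicial_fan F -> type_map s std_type = ftype F ->
  fanrel (rowsub s (fmx F)) std_type.
Proof.
move=> sF sT; apply/fanrel_rowsub; first exact: perm_inj.
by rewrite sT; exact: ftype_fanrel.
Qed.

Lemma nrm_fanrel (v : 'M[R]_(n, d)) : fanrel v std_type -> fanrel (std (nrm v)) std_type.
Proof.
move=> vE; have uv := std_type_head vE; rewrite std_nrm //.
by apply: fanrel_mulmx vE; rewrite unitmx_inv.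
Qed.

Lemma relabel_niso (F : cal_fan R d n p) (s : {perm 'I_n}) hb
    (hbE : fanrel (std hb) std_type) :
  simplicial_fan F -> type_map s std_type = ftype F ->
  nrm (rowsub s (fmx F)) = hb -> niso F (std_fan hbE).
Proof.
move=> sF sT hbN; have vE := relabel_fanrel sF sT; have uv := std_type_head vE.
apply: niso_sym; exists (rowsub head_idx (rowsub s (fmx F))), s; split=> //.
  by rewrite std_fan_ftype.
by rewrite std_fan_fmx -hbN std_nrm // mulmxKV.
Qed.

Local Notation N := ((n - d) * d)%N.

Lemma Ckm_vec (U : set 'rV[R]_N) k : Ckm U k (fun x => vec_mx x : 'M[R]_(n - d, d)).
Proof. by move=> i j; under eq_fun do rewrite mxE; exact: Ckr_coord. Qed.

Definition chart_dom : set 'rV[R]_N :=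
  [set x | fanrel (std (vec_mx x)) std_type].

Lemma chart_dom_open : open chart_dom.
Proof.
apply: (@open_comp _ _ (fun x : 'rV[R]_N => std (vec_mx x))
  [set v | fanrel v std_type]); last exact: fanrel_open.
move=> x _; apply: mx_continuous => i j.
apply: (@Ckr_continuous _ _ 0 setT) => //; move: i j.
exact: (Ckm_std openT (Ckm_vec _ _)).
Qed.

Definition relabel (s : {perm 'I_n}) (x : 'rV[R]_N) : 'rV[R]_N :=
  mxvec (nrm (rowsub s (std (vec_mx x)))).

(** Defined for every s: stabilizing permutations give the action on W, the others bring standard
    fans of another labelled type into W. *)
Definition relabel_dom (s : {perm 'I_n}) : set 'rV[R]_N :=
  [set x | rowsub head_idx (rowsub s (std (vec_mx x))) \in unitmx].

Lemma Ckm_relabel_head (s : {perm 'I_n}) U k : open U ->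
  Ckm U k (fun x : 'rV[R]_N => rowsub head_idx (rowsub s (std (vec_mx x)))).
Proof.
move=> oU i j; under eq_fun do rewrite 2!mxE.
exact: (Ckm_std oU (Ckm_vec _ _)).
Qed.

Lemma relabel_dom_open s : open (relabel_dom s).
Proof.
have -> : relabel_dom s = (fun x : 'rV[R]_N =>
    \det (rowsub head_idx (rowsub s (std (vec_mx x))))) @^-1` [set y | y != 0].
  by apply/seteqP; split=> x; rewrite /relabel_dom /= unitmxE unitfE.
apply: open_comp; last exact: open_neq.
move=> x _; apply: (@Ckr_continuous _ _ 0 setT) => //.
apply: Ckm_det; first exact: openT.
exact: (Ckm_relabel_head s 0 openT).
Qed.

Lemma relabel_smooth s : Cinf (relabel_dom s) (relabel s).
Proof.
have oU := @relabel_dom_open s.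
apply: Ckm_mxvec => // k; apply: Ckm_nrm => //.
by move=> i j; under eq_fun do rewrite mxE; exact: (Ckm_std oU (Ckm_vec _ _)).
Qed.

(** The group G, acting on all n indices: it preserves I_0 because all singletons of I_0 are in the
    type, and it permutes J freely. *)
Definition std_stab : {set {perm 'I_n}} :=
  [set s : {perm 'I_n} | type_map s std_type == std_type]%SET.

Lemma std_stab_group_set : group_set std_stab.
Proof.
apply/group_setP; split=> [|s s'].
  rewrite inE; apply/eqP; rewrite -[RHS]type_map_id.
  by apply: type_map_eq => i; rewrite perm1.
rewrite !inE => /eqP sE /eqP s'E; apply/eqP.
rewrite -[RHS]s'E -[in RHS]sE type_map_comp.
by apply: type_map_eq => i; rewrite permM.
Qed.

Definition std_stab_group : {group {perm 'I_n}} := Group std_stab_group_set.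

Local Notation gT := (subg_of std_stab_group).
Local Notation A := (open_manifold chart_dom_open).

Lemma chart_fanrel (x : A) : fanrel (std (vec_mx (set_val x))) std_type.
Proof. exact: (@set_valP _ chart_dom x). Qed.

Arguments chart_fanrel : clear implicits.

Lemma stab_fanrel (s : {perm 'I_n}) (v : 'M[R]_(n, d)) : s \in std_stab ->
  fanrel v std_type -> fanrel (rowsub s v) std_type.
Proof.
rewrite inE => /eqP sE vE; apply/fanrel_rowsub; first exact: perm_inj.
by rewrite sE.
Qed.

Lemma relabel_dom_stab s : s \in std_stab -> chart_dom `<=` relabel_dom s.
Proof. by move=> sS x xV; apply: std_type_head; exact: stab_fanrel. Qed.

Lemma relabel_chart s x : s \in std_stab -> chart_dom x -> chart_dom (relabel s x).
Proof.
move=> sS xV; rewrite /chart_dom /= mxvecK.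
by apply: nrm_fanrel; exact: stab_fanrel.
Qed.

Definition chart_act (g : gT) (x : A) : A :=
  exist _ (relabel (sgval g) (set_val x))
    (mem_set (relabel_chart (subgP g) (set_valP x))).

Lemma chart_act1 x : chart_act 1%g x = x.
Proof.
apply: val_inj => /=; rewrite /relabel.
have -> : rowsub (sgval (1%g : gT)) (std (vec_mx (set_val x))) = std (vec_mx (set_val x)).
  by apply/matrixP => i j; rewrite mxE /= perm1.
by rewrite nrm_std vec_mxK.
Qed.

(** Taking rows along s is contravariant while permutations compose from left to right, whence a
    left action. The intermediate normalization is a right multiplication by an invertible matrix,
    absorbed by [nrm]. *)
Lemma chart_actM g h x : chart_act (g * h)%g x = chart_act g (chart_act h x).
Proof.
apply: val_inj => /=; rewrite /relabel mxvecK; congr mxvec.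
have hE := stab_fanrel (subgP h) (chart_fanrel x).
have uh := std_type_head hE.
rewrite std_nrm // -mul_rowsub_mx nrm_mulmx ?unitmx_inv //; last first.
  exact/std_type_head/(stab_fanrel (subgP g)).
by congr nrm; apply/matrixP => i j; rewrite !mxE /= permM.
Qed.

Lemma chart_act_smooth g : smooth (chart_act g : A -> A).
Proof.
move=> x; have [c cA cx] := @matlas_cover _ A x.
have [c1 c2 c3] := cA; have oV := chart_dom_open.
apply: (@smooth_to_open _ _ _ oV A _ x c chart_dom) => //.
- by rewrite c3; exact: chart_fanrel.
- by rewrite c2.
apply: (@Cinf_ext _ _ _ _ (relabel (sgval g))) => //.
  move=> y Vy; rewrite -[in LHS](cinvK (c := c) (y := y)) ?c2 // c3.
  by [].
exact: Cinf_sub (relabel_dom_stab (subgP g)) (relabel_smooth _).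
Qed.

Local Notation M := (@moduli R d n p D).

Definition chart_fan (x : A) : cal_fan R d n p := std_fan (chart_fanrel x).

Lemma chart_fan_in_moduli x : in_moduli D (chart_fan x).
Proof. exact: std_fan_in_moduli. Qed.

Definition chart_proj (x : A) : M :=
  exist _ [set F | in_moduli D F /\ cal_iso (chart_fan x) F]
    (ex_intro _ (chart_fan x) (conj (chart_fan_in_moduli x) erefl)).

Lemma moduli_niso (F F' : cal_fan R d n p) : in_moduli D F -> in_moduli D F' ->
  cal_iso F F' <-> niso F F'.
Proof.
move=> [sF mF _] [sF' mF' _]; split; first exact: cal_iso_niso.
exact: niso_cal_iso.
Qed.

Lemma chart_projP (c : M) F x : sval c F -> niso F (chart_fan x) ->
  c = chart_proj x.
Proof.
case: c => C [F0 [mF0 CE]] /=; rewrite {1}CE => -[mF F0F] Fx.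
have mx := chart_fan_in_moduli x.
apply: eq_exist; rewrite CE; apply/seteqP; split=> F' /= [mF' iF']; split=> //.
  apply/(moduli_niso mx mF'); apply: niso_trans (niso_sym Fx) _.
  apply: niso_trans (niso_sym _) _; first exact/(moduli_niso mF0 mF)/F0F.
  exact/(moduli_niso mF0 mF').
apply/(moduli_niso mF0 mF').
apply: niso_trans ((moduli_niso mF0 mF).1 F0F) _.
by apply: niso_trans Fx _; exact/(moduli_niso mx mF').
Qed.

Lemma moduli_mem (c : M) F : sval c F -> in_moduli D F.
Proof. by case: c => C [F0 [mF0 CE]]; rewrite /= CE => -[]. Qed.

Lemma moduli_nonempty (c : M) : exists F, sval c F.
Proof.
case: c => C [F0 [mF0 CE]]; exists F0; rewrite /= CE; split=> //.
by apply/(moduli_niso mF0 mF0); exact: niso_refl.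
Qed.

Lemma chart_mem (x : A) : sval (chart_proj x) (chart_fan x).
Proof.
have mx := chart_fan_in_moduli x; split=> //.
by apply/(moduli_niso mx mx); exact: niso_refl.
Qed.

(** The permutation of an isomorphism between two standard fans stabilizes their common type, and
    its linear part disappears under normalization. *)
Lemma chart_proj_orbit x y :
  chart_proj x = chart_proj y <-> exists g, chart_act g x = y.
Proof.
have [mx my] := (chart_fan_in_moduli x, chart_fan_in_moduli y).
split=> [E|[g gxy]].
  have := chart_mem y; rewrite -E => -[_ /(moduli_niso mx my)[L [s [uL sT sL]]]].
  rewrite !std_fan_ftype in sT; rewrite !std_fan_fmx in sL.
  have sS : (s^-1)%g \in std_stab_group by rewrite groupV inE -sT.
  exists (subg std_stab_group (s^-1)%g); apply: val_inj => /=.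
  rewrite /relabel subgK // -[RHS]vec_mxK; congr mxvec.
  have ux := std_type_head (stab_fanrel sS (chart_fanrel x)).
  rewrite -(nrm_mulmx uL ux) mul_rowsub_mx sL -[RHS]nrm_std.
  by congr nrm; apply/matrixP => i j; rewrite !mxE permKV.
have sS := subgP g; have sS' : type_map (sgval g) std_type = std_type.
  by move: sS; rewrite inE => /eqP.
apply: (chart_projP (chart_mem x)).
apply: (relabel_niso (s := sgval g)); first exact: std_fan_simplicial.
  by rewrite std_fan_ftype.
by rewrite std_fan_fmx -gxy /= mxvecK.
Qed.

Lemma relabel_moduli (c : M) F (s : {perm 'I_n}) : sval c F ->
  type_map s std_type = ftype F ->
  exists2 x : A, c = chart_proj x &
    set_val x = mxvec (nrm (rowsub s (fmx F))).
Proof.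
move=> cF sT; have [sF _ _] := moduli_mem cF.
have yV : chart_dom (mxvec (nrm (rowsub s (fmx F)))).
  by rewrite /chart_dom /= mxvecK; exact/nrm_fanrel/relabel_fanrel.
exists (exist (fun z => z \in chart_dom) _ (mem_set yV) : A) => //.
apply: chart_projP cF _; apply: relabel_niso sF sT _.
by rewrite /= mxvecK.
Qed.

Lemma chart_proj_surj (c : M) : exists x, chart_proj x = c.
Proof.
have [F cF] := moduli_nonempty c.
have [s sT] := exists_relabel (moduli_mem cF).
by have [x -> _] := relabel_moduli cF sT; exists x.
Qed.

(** All fans of the chart have type [E0], so openness in the moduli space applies to them directly.
    Conversely, a standard fan of another type enters the chart by [relabel s], which is continuous
    at its parameter. *)
Lemma chart_proj_open (U : set M) : open U <-> open (chart_proj @^-1` U).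
Proof.
split=> [oU|oU].
  rewrite openE => x /= Ux; apply/nbhs_set_typeP.
  have := oU (chart_proj x) (chart_fan x) (vec_mx (set_val x)) Ux (chart_mem x)
    (std_fan_standard (chart_fanrel x)).
  have vc : {for set_val x, continuous (fun y : 'rV[R]_N => vec_mx y : 'M[R]_(n - d, d))}.
    apply: mx_continuous => i j.
    exact: (@Ckr_continuous _ _ 0 setT _ _ (@Ckm_vec setT 0 i j)).
  move=> /(near_continuous vc); apply: filterS => y /= H yV.
  apply: (H _ (chart_fan (exist _ y yV))); first exact: chart_mem.
    exact: std_fan_standard.
  by rewrite !std_fan_comb.
move=> c F hb Uc cF sF.
have [s sT] := exists_relabel (moduli_mem cF).
have fE := standard_fmx sF.
have [x cx xE] := relabel_moduli cF sT.
have Fs : simplicial_fan F by have [] := moduli_mem cF.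
have hbs : relabel_dom s (mxvec hb).
  rewrite /relabel_dom /= mxvecK -fE; apply: std_type_head.
  exact: relabel_fanrel.
have rc := Cinf_continuous (@relabel_dom_open s) (@relabel_smooth s) hbs.
have mc : {for hb, continuous (fun y : 'M[R]_(n - d, d) => mxvec y)}.
  apply: mx_continuous => i j; case/mxvec_indexP: j => k l; rewrite ord1.
  have -> : (fun y : 'M[R]_(n - d, d) => mxvec y 0 (mxvec_index k l)) =
      fun y => y k l by apply/funext => y; rewrite mxvecE.
  exact: coord_continuous.
have xr : set_val x = relabel s (mxvec hb) by rewrite xE fE /relabel mxvecK.
have : nbhs x (chart_proj @^-1` U).
  by apply: open_nbhs_nbhs; split=> //; rewrite /= -cx.
move=> /nbhs_set_typeP; rewrite xr => /(near_continuous rc)/(near_continuous mc).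
apply: filterS => hb' H c' F' c'F' sF' cE.
(* The same s serves all nearby standard fans, since their labelled type is that of F. *)
have sT' : type_map s std_type = ftype F'.
  by rewrite (standard_ftype sF') cE -(standard_ftype sF).
have [y -> yE] := relabel_moduli c'F' sT'.
have yr : set_val y = relabel s (mxvec hb').
  by rewrite yE (standard_fmx sF') /relabel mxvecK.
rewrite /= -yr in H; have := H (svalP y).
suff -> : exist _ (set_val y) (svalP y) = y by [].
exact: val_inj.
Qed.

Lemma chart_orbifold : orbifold_structure R M (d * (n - d))%N.
Proof.
have := quotient_orbifold_structure chart_act1 chart_actM chart_act_smooth
  chart_proj_surj chart_proj_orbit chart_proj_open.
by rewrite /= mulnC.
Qed.

End ModuliChart.

(** * The empty case and the conclusion *)

(** Quotient of the empty open subset of R^m by a trivial group; this keeps the dimension m. *)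
Lemma empty_orbifold (R : realType) (M : topologicalType) m :
  (M -> False) -> orbifold_structure R M m.
Proof.
move=> M0; pose A : manifold R := open_manifold (@open0 'rV[R]_m).
have A0 (x : A) : False by have := @set_valP _ set0 x.
pose pr (x : A) : M := match A0 x with end.
apply: (@quotient_orbifold_structure R A {perm 'I_0} (fun _ x => x) _ _ _ M pr).
- by [].
- by [].
- by move=> g x; case: (A0 x).
- by move=> c; case: (M0 c).
- by move=> a; case: (A0 a).
- move=> U; have -> : U = set0 by apply/seteqP; split=> c; case: (M0 c).
  by rewrite preimage_set0; split=> _; exact: open0.
Qed.

Theorem corollary11p18 (R : realType) (d n p : nat) (D : {set {set 'I_p}}) :
  (0 < d < n)%N ->
  (exists F : quantum_fan R d p,
     [/\ simplicial_fan F, comb_type F = D &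
         exists s : set 'rV[R]_d, qcones F s /\ cone_dim s d]) ->
  inhabited (orbifold_structure R (@moduli R d n p D) (d * (n - d))%N).
Proof.
move=> /andP[_ dn] [F [sF <- [s [Fs sd]]]].
(* I_0 consists of p distinct indices among n, so for p > n there is no calibrated fan at all. *)
have [np|pn] := ltnP n p.
  split; apply: empty_orbifold => -[C [G _]].
  have := leq_card _ (@cidx_inj _ _ _ _ G).
  by rewrite !card_ord leqNgt np.
have [J [JE vJ sJ]] := fan_cone_repr sF Fs.
have dJ : d = #|J| by apply/(cone_dim_on _ vJ); rewrite -sJ.
have dp : (d <= p)%N by rewrite dJ -[leqRHS]card_ord; exact: max_card.
pose f (i : 'I_d) : 'I_p := enum_val (cast_ord dJ i).
have finj : injective f by move=> i j /enum_val_inj/cast_ord_inj.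
have winj : injective (widen_ord dp).
  by move=> i j /(congr1 val)/= ij; exact: val_inj.
(* [t] relabels the generators of the d-dimensional cone as the first d ones. *)
have [t tE] := perm_extends finj winj.
have fJ : f @: [set: 'I_d]%SET = J.
  apply/eqP; rewrite eqEcard card_imset // cardsT card_ord -dJ leqnn andbT.
  by apply/fintype.subsetP => _ /imsetP[i _ ->]; exact: enum_valP.
have tsub (I K : {set 'I_p}) : K \subset t @: I -> exists2 K' : {set 'I_p},
    K' \subset I & K = t @: K'.
  move=> KI; exists (t @^-1: K).
    apply/fintype.subsetP => i; rewrite inE => /(fintype.subsetP KI).
    by rewrite mem_imset //; exact: perm_inj.
  apply/setP => i; apply/idP/imsetP => [iK|[j]]; last by rewrite inE => ? ->.
  by exists (t^-1%g i); rewrite ?inE permKV.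
split; apply: (@chart_orbifold R d n p (comb_type F)
  (type_map t (comb_type F)) dn pn dp t erefl).
- move=> I K KI /type_mapP[I' I'E IE]; rewrite IE in KI.
  have [K' K'I' ->] := tsub _ _ KI; apply/type_mapP; exists K' => //.
  exact: comb_type_sub sF _ _ K'I' I'E.
- by apply/type_mapP; exists finset.set0; rewrite ?imset0 //; exact: comb_type0.
- move=> k; apply/type_mapP; exists [set t^-1%g k]%SET; first exact: comb_type1.
  by rewrite imset_set1 permKV.
- apply/type_mapP; exists J => //; rewrite -fJ -imset_comp.
  apply/setP => i; rewrite inE; apply/idP/imsetP => [id|[j _ ->]].
    by exists (Ordinal id); rewrite ?inE //= tE; exact: val_inj.
  by rewrite /= tE /=.
Qed.
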